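(* The $S$-labeled graph $\Upsilon^{\mathbf m|\sigma}=(\mathcal K^J,\omega^{\mathbf m|\sigma},\mathrm{Asc}^{\mathbf m|\sigma})$ is a quasi-admissible $W$-graph, and the linear map with $Y_\tau\mapsto\underline M^\sigma_\tau$ is an isomorphism of $\mathcal H$-modules $\mathcal Y(\Upsilon^{\mathbf m|\sigma})\to\mathcal M^\sigma$.
   Context: Let $(W,S)$ be a finite Coxeter system with length $\ell$, Bruhat order $\le$, reflections $T=\{wsw^{-1}\}$. $\mathrm{Aut}(W,S)$: automorphisms preserving $S$; $W^+=W\rtimes\mathrm{Aut}(W,S)$, $(v,\alpha)(w,\beta)=(v\,\alpha(w),\alpha\beta)$, $\ell(w,\varphi)=\ell(w)$, $w\equiv(w,1)$. Perfect involution: $z\in W^+$ with $z^2=1$, $(zt)^4=1$ for all $t\in T$. Fix $J\subseteq S$; $W_J=\langle J\rangle$; $\mathscr I_J$ = perfect involutions of $W_J\rtimes\mathrm{Aut}(W_J,J)$, with $W_J$ acting by $v:(y,\theta)\mapsto(vy\theta(v)^{-1},\theta)$; $W_J$-minimal: $\ell(szs)\ge\ell(z)$ for $s\in J$ (unique per class). $W^J=\{w:\ell(ws)>\ell(w)\ \forall s\in J\}$, $\mathcal K^J=W^J\times\mathscr I_J$, $\mathrm{ht}(w,z)=\ell(w)+\tfrac12(\ell(z)-\ell(z_{\min}))$, $z_{\min}$ the $W_J$-minimal conjugate of $z$. $W$ acts on $\mathcal K^J$ by $s(w,z)=(sw,z)$ if $sw\in W^J$, else $(w,tzt)$ with $t=w^{-1}sw\in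 J$. Quasiparabolic Bruhat order on $\mathscr I_J$: transitive closure of $z<tzt$ ($t$ a reflection of $W_J$, $\ell(z)<\ell(tzt)$). $\prec$ on $\mathcal K^J$: $(w,z)\prec(w',z')$ iff same $W$-orbit, smaller $\mathrm{ht}$, and ($w<w'$ in Bruhat order, or $w=w'$ and $z<z'$). Fix a homomorphism $\sigma:W_J\to\{\pm1\}$; for $\tau=(w,z)$: $\mathrm{Asc}^<(\tau;\sigma)=\{s:\mathrm{ht}(s\tau)>\mathrm{ht}(\tau)\}$, $\mathrm{Des}^<(\tau;\sigma)=\{s:\mathrm{ht}(s\tau)<\mathrm{ht}(\tau)\}$, $\mathrm{Asc}^=(\tau;\sigma)=\{s:\mathrm{ht}(s\tau)=\mathrm{ht}(\tau),\sigma(w^{-1}sw)=-1\}$, $\mathrm{Des}^=(\tau;\sigma)=\{s:\mathrm{ht}(s\tau)=\mathrm{ht}(\tau),\sigma(w^{-1}sw)=1\}$; $\mathrm{Asc}^{\mathbf m|\sigma}(\tau)=\mathrm{Asc}^<(\tau;\sigma)\sqcup\mathrm{Asc}^=(\tau;\sigma)$. $\mathcal H$: Iwahori–Hecke algebra over $\mathbb Z[x,x^{-1}]$ with basis $H_w$, $H_sH_w=H_{sw}$ if $\ell(sw)>\ell(w)$, else $H_{sw}+(x-x^{-1})H_w$; bar operator: antilinear ($x\mapsto x^{-1}$) ring involution with $\overline{H_w}=(H_{w^{-1}})^{-1}$. $\mathcal M^\sigma$ is the free module with basis $M^\sigma_\tau$ ($\tau\in\mathcal K^J$) and $\mathcal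 H$-action $H_sM^\sigma_\tau=M^\sigma_{s\tau}$, $M^\sigma_{s\tau}+(x-x^{-1})M^\sigma_\tau$, $-x^{-1}M^\sigma_\tau$, $xM^\sigma_\tau$ according as $s\in\mathrm{Asc}^<,\mathrm{Des}^<,\mathrm{Asc}^=,\mathrm{Des}^=$ of $(\tau;\sigma)$; it has a unique antilinear map $\overline{\cdot}$ with $\overline{HM}=\overline H\,\overline M$ fixing $M^\sigma_\tau$ whenever $\mathrm{Des}^<(\tau;\sigma)=\varnothing$, and $\{\underline M^\sigma_\tau\}$ is the unique basis with $\overline{\underline M^\sigma_\tau}=\underline M^\sigma_\tau\in M^\sigma_\tau+\sum_{\upsilon\prec\tau}x^{-1}\mathbb Z[x^{-1}]M^\sigma_\upsilon$. Write $\underline M^\sigma_\tau=\sum_\upsilon\mathbf m^\sigma_{\upsilon\tau}M^\sigma_\upsilon$, $\mu^{\mathbf m|\sigma}_{\upsilon\tau}$ for the coefficient of $x^{-1}$ in $\mathbf m^\sigma_{\upsilon\tau}$, and $\omega^{\mathbf m|\sigma}(\tau,\upsilon)=\mu^{\mathbf m|\sigma}_{\upsilon\tau}+\mu^{\mathbf m|\sigma}_{\tau\upsilon}$ if $\mathrm{Asc}^{\mathbf m|\sigma}(\tau)\not\subset\mathrm{Asc}^{\mathbf m|\sigma}(\upsilon)$ and $0$ otherwise. An $S$-labeled graph $\Gamma=(V,\omega,I)$ has $\omega:V\times V\to\mathbb Z[x,x^{-1}]$, $I:V\to 2^S$, with directed edges $u\to v$ when $\omega(u,v)\ne0$. It is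 a $W$-graph if the free module $\mathcal Y(\Gamma)$ with basis $Y_v$ has an $\mathcal H$-module structure with $H_sY_u=xY_u$ if $s\notin I(u)$ and $H_sY_u=-x^{-1}Y_u+\sum_{v:\,s\notin I(v)}\omega(u,v)Y_v$ if $s\in I(u)$. It is quasi-admissible if (1) its directed graph is bipartite, (2) all $\omega(u,v)\in\mathbb Z$, (3) $\omega(u,v)=0$ whenever $I(u)\subset I(v)$, (4) $\omega(u,v)=\omega(v,u)$ whenever $I(u)\not\subset I(v)\not\subset I(u)$. *)

(* Defs.v *)
From HB Require Import structures.
From mathcomp Require Import all_boot all_order all_fingroup all_algebra.
From Stdlib Require Import ClassicalEpsilon.
Set Implicit Arguments. Unset Strict Implicit. Unset Printing Implicit Defensive.
Import GRing.Theory.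
Local Open Scope ring_scope.

(* The ring Z[x, x^-1] of Laurent polynomials, realized as the subring *)
(* of the fraction field of Z[x] consisting of the f with f x^n in Z[x]. *)

Definition Frac := {fraction {poly int}}.
Definition xF : Frac := tofrac 'X.
Definition laurentP (f : Frac) : Prop :=
  exists (n : nat) (p : {poly int}), f * xF ^+ n = tofrac p.
Definition lb (f : Frac) : bool :=
  if excluded_middle_informative (laurentP f) then true else false.
Lemma lbP f : reflect (laurentP f) (lb f).
Proof. rewrite /lb; case: excluded_middle_informative => h; constructor => //. Qed.

Lemma lb_subring : subring_closed lb.
Proof.
split.
- by apply/lbP; exists 0%N, 1; rewrite expr0 mulr1 tofrac1.
- move=> a b /lbP[n [p Hp]] /lbP[m [q Hq]]; apply/lbP.
  exists (n + m)%N, (p * 'X^m - q * 'X^n).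
  rewrite tofracB !tofracM -Hp -Hq.
  have ->: tofrac ('X^m : {poly int}) = xF ^+ m by rewrite /xF rmorphXn.
  have ->: tofrac ('X^n : {poly int}) = xF ^+ n by rewrite /xF rmorphXn.
  by rewrite mulrBl exprD !mulrA -!mulrA [xF ^+ m * _]mulrC.
- move=> a b /lbP[n [p Hp]] /lbP[m [q Hq]]; apply/lbP.
  exists (n + m)%N, (p * q).
  by rewrite tofracM -Hp -Hq exprD mulrACA.
Qed.

HB.instance Definition _ := GRing.isSubringClosed.Build Frac lb lb_subring.

Record laurent := Laurent { lval :> Frac; _ : lb lval }.
HB.instance Definition _ := [isSub for lval].
HB.instance Definition _ := [Choice of laurent by <:].
HB.instance Definition _ := [SubChoice_isSubComNzRing of laurent by <:].

Lemma xF_neq0 : xF != 0.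
Proof. by rewrite /xF tofrac_eq0 polyX_eq0. Qed.

Lemma lb_xF : lb xF.
Proof. by apply/lbP; exists 0%N, 'X; rewrite expr0 mulr1. Qed.

Lemma lb_xFV : lb xF^-1.
Proof. by apply/lbP; exists 1%N, 1; rewrite expr1 mulVf ?xF_neq0 // tofrac1. Qed.

Definition xL : laurent := Laurent lb_xF.
Definition xiL : laurent := Laurent lb_xFV.

Definition lrep (f : laurent) :
  {np : nat * {poly int} | lval f * xF ^+ np.1 = tofrac np.2}.
Proof.
apply: constructive_indefinite_description.
have /lbP [n [p Hp]] := valP f.
by exists (n, p).
Defined.

Definition coefL (f : laurent) (k : int) : int :=
  let np := proj1_sig (lrep f) in
  let i := (k + (np.1)%:Z)%R in
  if (0 <= i)%R then np.2`_(absz i) else 0.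

Definition inZ (f : laurent) : Prop := exists k : int, f = k%:~R.

Definition in_xiZxi (f : laurent) : Prop :=
  exists p : {poly int}, p`_0 = 0 /\ f = \sum_(i < size p) (p`_i)%:~R * xiL ^+ i.

Definition vec (V : finType) := {ffun V -> laurent}.
Definition sc (V : finType) (a : laurent) (v : vec V) : vec V :=
  [ffun u => a * v u].
Definition ev (V : finType) (a : V) : vec V := [ffun u => (u == a)%:R].

Section Coxeter.
Variable gT : finGroupType.
Local Open Scope group_scope.

Definition wordset (S : {set gT}) (n : nat) : {set gT} :=
  iter n (fun A => A * S) [set 1].
Definition len (S : {set gT}) (w : gT) : nat :=
  find (fun n => w \in wordset S n) (iota 0 #|gT|.+1).

Definition prodw (ws : seq gT) : gT := \prod_(t <- ws) t.

(* (W,S) is a (finite) Coxeter system: S is a generating set of involutions *)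
(* satisfying the exchange condition (Bourbaki, Ch. IV, 1.6, Thm 1).       *)
Definition coxeter_system (W : {group gT}) (S : {set gT}) : Prop :=
  [/\ (W : {set gT}) = <<S>>, 1 \notin S, {in S, forall s, s * s = 1} &
      forall (s : gT) (ws : seq gT), s \in S -> all (mem S) ws ->
        len S (prodw ws) = size ws -> (len S (s * prodw ws) < size ws)%N ->
        exists2 i, (i < size ws)%N & s * prodw ws = prodw (take i ws ++ drop i.+1 ws)].

Definition refl (W : {set gT}) (S : {set gT}) : {set gT} :=
  [set w * s * w^-1 | w in W, s in S].

Definition brel (W S : {set gT}) : rel gT :=
  fun u v => [exists t in refl W S, (v == u * t) && (len S u < len S v)%N].
Definition bruhat_lt (W S : {set gT}) (u v : gT) : bool :=
  [exists y, brel W S u y && connect (brel W S) y v].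

(* W^+_J = W_J x| Aut(W_J, J): pairs (y, theta), theta a permutation of gT *)
(* which is an automorphism of W_J (identity outside W_J) with theta(J)=J.  *)
Definition AutJ (J : {set gT}) : {set {perm gT}} :=
  [set a in Aut <<J>> | [set a x | x in J] == J].
Definition Tp := (gT * {perm gT})%type.
(* (v,a)(w,b) = (v a(w), a b);  a b = a o b is (b * a)%g for perms *)
Definition mulP (a b : Tp) : Tp := (a.1 * a.2 b.1, b.2 * a.2).
Definition oneP : Tp := (1, 1).
Definition inWpJ (J : {set gT}) (z : Tp) : bool := (z.1 \in <<J>>) && (z.2 \in AutJ J).

Definition perfect (J : {set gT}) (z : Tp) : bool :=
  [&& inWpJ J z, mulP z z == oneP &
      [forall t in refl <<J>> J,
         let a := mulP z (t, 1) in mulP (mulP a a) (mulP a a) == oneP]].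
Definition IJ (J : {set gT}) : {set Tp} := [set z | perfect J z].

Definition actJ (v : gT) (z : Tp) : Tp := (v * z.1 * (z.2 v)^-1, z.2).
Definition conjP (t : gT) (z : Tp) : Tp := mulP (mulP (t, 1) z) (t, 1).
Definition minimalJ (S J : {set gT}) (z : Tp) : bool :=
  [forall s in J, (len S z.1 <= len S (conjP s z).1)%N].
Definition zmin (S J : {set gT}) (z : Tp) : Tp :=
  odflt z [pick z' in [set actJ v z | v in <<J>>] | minimalJ S J z'].

Definition Tk := (gT * Tp)%type.

(* ht(w,z) = l(w) + (l(z) - l(z_min))/2  (the difference is even and >= 0) *)
Definition ht (S J : {set gT}) (tau : Tk) : nat :=
  (len S tau.1 + (len S tau.2.1 - len S (zmin S J tau.2).1)./2)%N.

Definition WJ (W S J : {set gT}) : {set gT} :=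
  [set w in W | [forall s in J, (len S w < len S (w * s))%N]].
Definition Kset (W S J : {set gT}) : {set Tk} :=
  [set tau | (tau.1 \in WJ W S J) && (tau.2 \in IJ J)].

Definition actK (W S J : {set gT}) (s : gT) (tau : Tk) : Tk :=
  if s * tau.1 \in WJ W S J then (s * tau.1, tau.2)
  else (tau.1, conjP (tau.1^-1 * s * tau.1) tau.2).

Definition qprel (S J : {set gT}) : rel Tp :=
  fun z z' => [exists t in refl <<J>> J,
                 (z' == conjP t z) && (len S z.1 < len S z'.1)%N].
Definition qp_lt (S J : {set gT}) (z z' : Tp) : bool :=
  [exists y, qprel S J z y && connect (qprel S J) y z'].

Definition orbrel (W S J : {set gT}) : rel Tk :=
  fun a b => [exists s in S, b == actK W S J s a].

Definition precK (W S J : {set gT}) (a b : Tk) : bool :=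
  [&& connect (orbrel W S J) a b, (ht S J a < ht S J b)%N &
      bruhat_lt W S a.1 b.1 || ((a.1 == b.1) && qp_lt S J a.2 b.2)].

Definition sgnK (sigma : gT -> int) (s : gT) (tau : Tk) : int :=
  sigma (tau.1^-1 * s * tau.1).

Definition AscM (W S J : {set gT}) (sigma : gT -> int) (tau : Tk) : {set gT} :=
  [set s in S | (ht S J tau < ht S J (actK W S J s tau))%N
     || ((ht S J (actK W S J s tau) == ht S J tau) && (sgnK sigma s tau == -1)%R)].

Definition DesLtEmpty (W S J : {set gT}) (tau : Tk) : bool :=
  [forall s in S, ~~ (ht S J (actK W S J s tau) < ht S J tau)%N].

(* An H-module structure on the free module vec V: rho w is the action  *)
(* of the standard basis element H_w (w in W); it is L-linear, H_1 acts *)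
(* trivially, and H_s H_w = H_{sw} if l(sw) > l(w), else                 *)
(* H_{sw} + (x - x^-1) H_w.                                              *)
Definition hecke_rep (W S : {set gT}) (V : finType)
    (rho : gT -> vec V -> vec V) : Prop :=
  [/\ forall w, w \in W -> forall a m m',
        rho w (sc a m + m')%R = (sc a (rho w m) + rho w m')%R,
      forall m, rho 1 m = m &
      forall s w, s \in S -> w \in W -> forall m,
        rho s (rho w m) =
          if (len S w < len S (s * w))%N then rho (s * w) m
          else (rho (s * w)%g m + sc (xL - xiL)%R (rho w m))%R].

Definition imgY (V : finType) (omega : V -> V -> laurent) (I : V -> {set gT})
    (s : gT) (u : V) : vec V :=
  if s \notin I u then sc xL (ev u)
  else (sc (- xiL)%R (ev u) + \sum_(v | s \notin I v) sc (omega u v) (ev v))%R.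
Definition opY (V : finType) (omega : V -> V -> laurent) (I : V -> {set gT})
    (s : gT) (y : vec V) : vec V :=
  (\sum_u sc (y u) (imgY omega I s u))%R.

Definition is_Wgraph (W S : {set gT}) (V : finType)
    (omega : V -> V -> laurent) (I : V -> {set gT}) : Prop :=
  (forall u, I u \subset S) /\
  exists rho : gT -> vec V -> vec V, hecke_rep W S rho /\
    forall s, s \in S -> forall y, rho s y = opY omega I s y.

Definition quasi_admissible (V : finType)
    (omega : V -> V -> laurent) (I : V -> {set gT}) : Prop :=
  [/\ exists f : V -> bool, forall u v, omega u v != 0 -> f u != f v,
      forall u v, inZ (omega u v),
      forall u v, I u \subset I v -> omega u v = 0 &
      forall u v, ~~ (I u \subset I v) -> ~~ (I v \subset I u) ->
        omega u v = omega v u].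

End Coxeter.

Definition KT (gT : finGroupType) (W S J : {set gT}) : finType :=
  {tau : Tk gT | tau \in Kset W S J}.

Definition evK (gT : finGroupType) (W S J : {set gT}) (a : Tk gT) : vec (KT W S J) :=
  [ffun u => (val u == a)%:R].

Definition imgM (gT : finGroupType) (W S J : {set gT}) (sigma : gT -> int)
    (s : gT) (tau : Tk gT) : vec (KT W S J) :=
  let stau := actK W S J s tau in
  if (ht S J tau < ht S J stau)%N then evK W S J stau
  else if (ht S J stau < ht S J tau)%N then
    (evK W S J stau + sc (xL - xiL) (evK W S J tau))%R
  else if sgnK sigma s tau == -1 then sc (- xiL) (evK W S J tau)
  else sc xL (evK W S J tau).
Definition opM (gT : finGroupType) (W S J : {set gT}) (sigma : gT -> int)
    (s : gT) (m : vec (KT W S J)) : vec (KT W S J) :=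
  (\sum_u sc (m u) (imgM W S J sigma s (val u)))%R.

(* mu^{m|sigma}_{u,tau} = coefficient of x^-1 in m_{u,tau} = C tau u *)
Definition muC (gT : finGroupType) (W S J : {set gT})
    (C : KT W S J -> vec (KT W S J)) (u tau : KT W S J) : int :=
  coefL (C tau u) (-1).

Definition omegaC (gT : finGroupType) (W S J : {set gT}) (sigma : gT -> int)
    (C : KT W S J -> vec (KT W S J)) (tau u : KT W S J) : laurent :=
  if ~~ (AscM W S J sigma (val tau) \subset AscM W S J sigma (val u))
  then ((muC C u tau + muC C tau u)%R)%:~R else 0.

Definition IC (gT : finGroupType) (W S J : {set gT}) (sigma : gT -> int)
    (tau : KT W S J) : {set gT} := AscM W S J sigma (val tau).

Definition phiC (gT : finGroupType) (W S J : {set gT})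
    (C : KT W S J -> vec (KT W S J)) (y : vec (KT W S J)) : vec (KT W S J) :=
  (\sum_u sc (y u) (C u))%R.

Arguments evK {gT} W S J a.
Arguments imgM {gT} W S J sigma s tau.
Arguments opM {gT} W S J sigma s m.
Arguments muC {gT} W S J C u tau.
Arguments omegaC {gT} W S J sigma C tau u.
Arguments IC {gT} W S J sigma tau.
Arguments phiC {gT} W S J C y.

(* Main.v *)
(* Write M_t for the standard basis, C_t for the canonical one, and T for the  *)
(* operator H_s. A bar invariant vector with coefficients in x^-1 Z[x^-1] is   *)
(* zero, so a bar invariant vector with coefficients in Z[x^-1] is the integer *)
(* combination of the C_t read off from its constant terms. Applied to         *)
(* (T + x^-1) C_t for an ascent t, and to (T - x) C_t for a descent t, this    *)
(* gives integer combinations of descents, resp. of ascents. The second one    *)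
(* vanishes: the x-eigenspace of T contains a vector with leading term C_t,    *)
(* which makes each coefficient a multiple of x + x^-1. Comparing coefficients *)
(* in T C_t = x C_t then identifies the integers of the first combination with *)
(* the weights omega. Bipartiteness holds because the exponents of x in the    *)
(* coefficient of M_u in C_t have the parity of ht t - ht u, by induction on   *)
(* the height, starting from C_t = M_t when t has no strict descent.           *)

Require Import Defs.
From HB Require Import structures.
From mathcomp Require Import all_boot all_order all_fingroup all_algebra.
From mathcomp Require Import zify ring.
Set Implicit Arguments. Unset Strict Implicit. Unset Printing Implicit Defensive.
Import Order.TTheory GRing.Theory Num.Theory.
Local Open Scope ring_scope.

(** * Coefficients of Laurent polynomials *)

(** The W-graph formulas prescribe the matrix of each H_s in the basis Y_u. The C_t are
    unitriangular for the height, so [phiC] is bijective and the claim reduces to computing H_s C_t,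
    one generator at a time. The section [Generator] does this for an abstract operator T that obeys
    the quadratic relation and is compatible with bar. There [bar_expand] turns bounds on exponents
    into integer expansions, [kl_asc] gives the expansion at an ascent, [T_can_des] the eigenvalue x
    at a descent, and [mu_asc_des] rewrites the extra term of [kl_asc] as the second half of the
    symmetric weight in [T_can_asc].

    Two facts bring the perfect model under this scheme. The generator s acts on the basis as an
    involution once it is made to fix the elements whose height it keeps ([stepK]). It changes the
    height by at most one ([ht_step], through [deodhar]), which drives the parity argument of
    [parity_step] and [can_parity]. The module structure on Y is then that of M^sigma pulled back
    along [phiC]. *)

Definition coefz (p : {poly int}) (i : int) : int :=
  if 0 <= i then p`_(absz i) else 0.

Lemma coefzMXn p m i : coefz (p * 'X^m) i = coefz p (i - m%:Z).
Proof.
rewrite /coefz coefMXn; case: ifP => hi; last by case: ifP => //; lia.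
case: ifP => hm; first by case: ifP => //; lia.
by case: ifP => h; [congr (_ `_ _); lia | lia].
Qed.

Lemma coefzD p r i : coefz (p + r) i = coefz p i + coefz r i.
Proof. by rewrite /coefz coefD; case: ifP => // _; rewrite addr0. Qed.

Lemma coefzN p i : coefz (- p) i = - coefz p i.
Proof. by rewrite /coefz coefN; case: ifP => // _; rewrite oppr0. Qed.

Lemma tofrac_polyXn n : tofrac 'X^n = xF ^+ n :> Frac.
Proof. by rewrite /xF rmorphXn. Qed.

Lemma laurent_rep (f : laurent) : exists n p, lval f * xF ^+ n = tofrac p.
Proof. by have /lbP := valP f. Qed.

(** [coefL] reads a representative picked by choice. Two representatives agree after
    cross-multiplication by powers of x, so any one of them may be used. *)
Lemma coefL_rep f n p k :
  lval f * xF ^+ n = tofrac p -> coefL f k = coefz p (k + n%:Z).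
Proof.
move=> Hp; rewrite /coefL -/(coefz _ _).
case: (lrep f) => -[m r] /= Hr.
have E : p * 'X^m = r * 'X^n.
  by apply/eqP; rewrite -tofrac_eq; apply/eqP; rewrite !tofracM !tofrac_polyXn -Hp -Hr mulrAC.
have : coefz (p * 'X^m) (k + m%:Z + n%:Z) = coefz (r * 'X^n) (k + m%:Z + n%:Z).
  by rewrite E.
by rewrite !coefzMXn addrK [k + _ + n%:Z]addrAC addrK.
Qed.

Lemma coefLB k : {morph (coefL^~ k) : f g / f - g}.
Proof.
move=> f g; have [n [p Hp]] := laurent_rep f; have [m [r Hr]] := laurent_rep g.
rewrite (coefL_rep k Hp) (coefL_rep k Hr).
have H : lval (f - g) * xF ^+ (n + m) = tofrac (p * 'X^m - r * 'X^n).
  rewrite tofracB !tofracM !tofrac_polyXn -Hp -Hr exprD /=; ring.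
rewrite (coefL_rep k H) coefzD coefzN !coefzMXn PoszD addrA addrK.
by rewrite [k + _ + _]addrAC addrK.
Qed.

(** Taking the exponent first makes extraction at k a function that can carry the additive
    structure. *)
Definition coefLk (k : int) (f : laurent) : int := coefL f k.
HB.instance Definition _ k :=
  GRing.isZmodMorphism.Build laurent int (coefLk k) (coefLB k).

Lemma coefLD f g k : coefL (f + g) k = coefL f k + coefL g k.
Proof. exact: (raddfD (coefLk k)). Qed.

Lemma coefLN f k : coefL (- f) k = - coefL f k.
Proof. exact: (raddfN (coefLk k)). Qed.

Lemma coefL0 k : coefL 0 k = 0.
Proof. exact: (raddf0 (coefLk k)). Qed.

Lemma coefL_sum (I : Type) (r : seq I) (P : pred I) F k :
  coefL (\sum_(i <- r | P i) F i) k = \sum_(i <- r | P i) coefL (F i) k.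
Proof. exact: (raddf_sum (coefLk k)). Qed.

Lemma coefLZ (c : int) f k : coefL (c%:~R * f) k = c * coefL f k.
Proof.
rewrite mulrzl -[coefL (f *~ c) k]/(coefLk k (f *~ c)) raddfMz.
by rewrite -mulrzl intz.
Qed.

Lemma xLxiL : xL * xiL = 1.
Proof. by apply/val_inj; rewrite /= mulfV // xF_neq0. Qed.

Lemma coefLMx f k : coefL (xL * f) k = coefL f (k - 1).
Proof.
have [n [p Hp]] := laurent_rep f.
have H : lval (xL * f) * xF ^+ n = tofrac (p * 'X^1).
  by rewrite tofracM tofrac_polyXn -Hp expr1 /=; ring.
by rewrite (coefL_rep k H) (coefL_rep _ Hp) coefzMXn addrAC.
Qed.

Lemma coefLMxi f k : coefL (xiL * f) k = coefL f (k + 1).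
Proof. by rewrite -{2}[f]mul1r -xLxiL -mulrA coefLMx addrK. Qed.

Lemma coefL1 k : coefL 1 k = (k == 0)%:R.
Proof.
have H : lval 1 * xF ^+ 0 = tofrac 1 by rewrite expr0 mulr1 tofrac1.
rewrite (coefL_rep k H) addr0 /coefz coef1.
by case: ifP => h; [congr (_%:R); lia | case: eqP => //; lia].
Qed.

Lemma coefL_eq0 f : (forall k, coefL f k = 0) -> f = 0.
Proof.
have [n [p Hp]] := laurent_rep f => H.
have p0 : p = 0.
  apply/polyP => i; have := H (i%:Z - n%:Z).
  by rewrite (coefL_rep _ Hp) subrK coef0 /coefz.
apply/val_inj/eqP; move/eqP: Hp; rewrite p0 tofrac0 mulf_eq0 expf_eq0.
by rewrite (negPf xF_neq0) andbF orbF.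
Qed.

Lemma coefL_support f : exists N : nat, forall k, (N < absz k)%N -> coefL f k = 0.
Proof.
have [n [p Hp]] := laurent_rep f; exists (n + size p)%N => k hk.
rewrite (coefL_rep _ Hp) /coefz; case: ifP => // h.
by apply: nth_default; move: (size p) hk => m; lia.
Qed.

(** The ring is generated from 1 by subtraction and multiplication by x and x^-1. This suits [barL],
    which is known only as a ring morphism with a given value at x. *)
Lemma laurent_ind (P : laurent -> Prop) :
  P 1 -> (forall f g, P f -> P g -> P (f - g)) ->
  (forall f, P f -> P (xL * f)) -> (forall f, P f -> P (xiL * f)) ->
  forall f, P f.
Proof.
move=> P1 PB Px Pxi f; have [n [p Hp]] := laurent_rep f.
have P0 : P 0 by rewrite -(subrr 1); apply: PB.
have PN g : P g -> P (- g) by move=> Pg; rewrite -sub0r; apply: PB.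
have PD g g' : P g -> P g' -> P (g + g').
  by move=> Pg Pg'; rewrite -[g']opprK; apply: PB => //; apply: PN.
have Pn m : P m%:R.
  by elim: m => [//|m IH]; rewrite -natr1; apply: PD.
have Pz (c : int) : P c%:~R.
  by case: c => m; [exact: Pn | rewrite NegzE mulrNz; apply/PN/Pn].
have Pp : exists2 g : laurent, P g & lval g = tofrac p.
  elim/poly_ind: p {Hp} => [|p c [g Pg Hg]].
    by exists 0 => //; rewrite tofrac0.
  exists (xL * g + c%:~R); first by apply: PD => //; apply: Px.
  rewrite tofracD tofracM -Hg [lval g * _]mulrC; congr (_ + _).
  have -> : c%:P = c%:~R :> {poly int} by rewrite -{1}[c]intz rmorph_int.
  by rewrite [RHS]rmorph_int; apply: (rmorph_int val).
case: Pp => g Pg Hg.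
have -> : f = xiL ^+ n * g.
  apply/val_inj; rewrite rmorphM rmorphXn /= Hg -Hp mulrCA mulrC -exprMn.
  by rewrite mulVf ?xF_neq0 // expr1n mul1r.
elim: n {Hp} => [|n IH]; first by rewrite expr0 mul1r.
by rewrite exprS -mulrA; apply: Pxi.
Qed.

Lemma barL_xiL (barL : {rmorphism laurent -> laurent}) :
  barL xL = xiL -> barL xiL = xL.
Proof.
move=> hx; have /(congr1 ( *%R xL)) := congr1 barL xLxiL.
by rewrite rmorphM hx rmorph1 mulr1 mulrA xLxiL mul1r.
Qed.

Lemma coefL_bar (barL : {rmorphism laurent -> laurent}) :
  barL xL = xiL -> forall f k, coefL (barL f) k = coefL f (- k).
Proof.
move=> hx; elim/laurent_ind => [k|f g Hf Hg k|f Hf k|f Hf k].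
- by rewrite rmorph1 !coefL1 oppr_eq0.
- by rewrite rmorphB !coefLD !coefLN Hf Hg.
- by rewrite rmorphM hx coefLMxi coefLMx Hf opprD.
- by rewrite rmorphM (barL_xiL hx) coefLMxi coefLMx Hf opprB addrC.
Qed.

(** Membership in x^-1 Z[x^-1], phrased by coefficients so that no polynomial has to be
    exhibited. *)
Definition negL (f : laurent) : Prop := forall k, 0 <= k -> coefL f k = 0.

Lemma in_xiZxi_neg f : in_xiZxi f -> negL f.
Proof.
move=> [p [p0 ->]] k hk; rewrite coefL_sum big1 // => i _.
rewrite coefLZ; case: i => [[|i] Hi] /=; first by rewrite p0 mul0r.
suff -> : coefL (xiL ^+ i.+1) k = 0 by rewrite mulr0.
elim: i k hk {Hi} => [|i IH] k hk; last by rewrite exprS coefLMxi IH //; lia.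
by rewrite -[xiL ^+ 1]mulr1 expr1 coefLMxi coefL1; case: eqP => //; lia.
Qed.

(** The coefficients are symmetric under negating the exponent, and half of them vanish. *)
Lemma negL_bar_eq0 (barL : {rmorphism laurent -> laurent}) f :
  barL xL = xiL -> barL f = f -> negL f -> f = 0.
Proof.
move=> hx fE fneg; apply: coefL_eq0 => k; have [/fneg//|hk] := boolP (0 <= k).
by rewrite -fE (coefL_bar hx); apply: fneg; lia.
Qed.

(* Comparing coefficients, those of f satisfy c_(k+1) = - c_(k-1) for k != 0, *)
(* which is incompatible with finite support.                                 *)
Lemma quantum2_int f (a : int) : (xL + xiL) * f = a%:~R -> f = 0.
Proof.
move=> E.
have rec k : k != 0 -> coefL f (k + 1) = - coefL f (k - 1).
  move=> /negPf k0; have /(congr1 (coefL^~ k)) := E; rewrite -[a%:~R]mulr1.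
  rewrite mulrDl coefLZ coefLD coefLMx coefLMxi coefL1 k0 mulr0 addrC => /eqP.
  by rewrite addr_eq0 => /eqP.
have [N HN] := coefL_support f.
(* Induction on the distance n to the region where f vanishes. Steps of two lead away from 0, in the
   direction given by the sign of k, so the middle exponent in [rec] is never 0. *)
suff H n (k : int) : (N < absz k + n)%N -> coefL f k = 0.
  by apply: coefL_eq0 => k; apply: (H N.+1); lia.
elim: n k => [|n IH] k hk; first by apply: HN; lia.
have [hk0|hk0] := boolP (0 <= k).
  have := rec (k + 1) ltac:(lia); rewrite addrK => /eqP.
  by rewrite -eqr_oppLR => /eqP <-; rewrite IH ?oppr0 //; lia.
have := rec (k - 1) ltac:(lia); rewrite subrK => ->.
by rewrite IH ?oppr0 //; lia.
Qed.

Lemma xL_sub_xiL_neq0 : xL - xiL != 0.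
Proof.
apply/eqP => /(congr1 (coefL^~ 1)).
rewrite -[xL]mulr1 -[xiL]mulr1 coefLD coefLN coefLMx coefLMxi !coefL1 coefL0 //.
Qed.

Lemma laurent_mulf_eq0 (f g : laurent) : f * g = 0 -> f != 0 -> g = 0.
Proof.
move=> /(congr1 val) /= /eqP; rewrite mulf_eq0 => /orP[/eqP H|/eqP H _].
  by move/eqP; case; apply/val_inj.
exact/val_inj.
Qed.

(** All exponents of f have the parity of n; signs are irrelevant mod 2, so sums of heights replace
    differences. *)
Definition parL (f : laurent) (n : nat) : Prop :=
  forall k, coefL f k != 0 -> odd (absz k) = odd n.

Lemma parL0 n : parL 0 n.
Proof. by move=> k; rewrite coefL0 eqxx. Qed.

Lemma parL1 n : odd n = false -> parL 1 n.
Proof. by move=> hn k; rewrite coefL1; have [->|_] := eqVneq k 0; rewrite ?hn ?eqxx. Qed.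

Lemma parLD f g n : parL f n -> parL g n -> parL (f + g) n.
Proof.
move=> Hf Hg k; rewrite coefLD; have [f0|/Hf//] := eqVneq (coefL f k) 0.
by rewrite f0 add0r => /Hg.
Qed.

Lemma parLZ (c : int) f n : parL f n -> parL (c%:~R * f) n.
Proof. by move=> Hf k; rewrite coefLZ mulf_eq0 negb_or => /andP[_ /Hf]. Qed.

Lemma parL_sum (I : Type) (r : seq I) (P : pred I) F n :
  (forall i, P i -> parL (F i) n) -> parL (\sum_(i <- r | P i) F i) n.
Proof.
by move=> H; apply: (big_ind (parL^~ n)) => //; [exact: parL0 | move=> *; exact: parLD].
Qed.

Lemma parLMx f n : parL f n -> parL (xL * f) n.+1.
Proof. by move=> Hf k; rewrite coefLMx => /Hf; lia. Qed.

Lemma parLMxi f n : parL f n -> parL (xiL * f) n.+1.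
Proof. by move=> Hf k; rewrite coefLMxi => /Hf; lia. Qed.

Lemma parL_congr f n m : odd n = odd m -> parL f n -> parL f m.
Proof. by move=> e Hf k /Hf ->. Qed.

(** * Linear and antilinear maps, treated together *)

Definition semilin (V : finType) (th : laurent -> laurent)
    (T : vec V -> vec V) : Prop :=
  forall a m m', T (sc a m + m') = sc (th a) (T m) + T m'.

Lemma vec_scE (V : finType) a (m : vec V) u : sc a m u = a * m u.
Proof. by rewrite ffunE. Qed.

Lemma sc1 (V : finType) (m : vec V) : sc 1 m = m.
Proof. by apply/ffunP => u; rewrite ffunE mul1r. Qed.

Lemma sc0 (V : finType) (m : vec V) : sc 0 m = 0.
Proof. by apply/ffunP => u; rewrite !ffunE mul0r. Qed.

Section Semilinear.
Variables (V : finType) (th : {rmorphism laurent -> laurent}) (T : vec V -> vec V).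
Hypothesis hT : semilin th T.

Lemma semilinD m m' : T (m + m') = T m + T m'.
Proof. by have := hT 1 m m'; rewrite rmorph1 !sc1. Qed.

Lemma semilin0 : T 0 = 0.
Proof. by apply: (addrI (T 0)); rewrite -semilinD !addr0. Qed.

Lemma semilinZ a m : T (sc a m) = sc (th a) (T m).
Proof. by have := hT a m 0; rewrite semilin0 !addr0. Qed.

Lemma semilinN m : T (- m) = - T m.
Proof. by apply: (addrI (T m)); rewrite -semilinD !subrr semilin0. Qed.

Lemma semilin_sum (I : Type) (r : seq I) (P : pred I) (F : I -> vec V) :
  T (\sum_(i <- r | P i) F i) = \sum_(i <- r | P i) T (F i).
Proof. exact: (big_morph T semilinD semilin0). Qed.

Lemma semilin_lincomb (I : Type) (r : seq I) (P : pred I) c (F : I -> vec V) :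
  T (\sum_(i <- r | P i) sc (c i) (F i)) =
  \sum_(i <- r | P i) sc (th (c i)) (T (F i)).
Proof. by rewrite semilin_sum; apply: eq_bigr => i _; rewrite semilinZ. Qed.

End Semilinear.

Definition idL : {rmorphism laurent -> laurent} := idfun.

(** * Canonical bases of modules with a bar operator *)

Section CanonicalBasis.
Variables (V : finType) (h : V -> nat).
Variables (barL : {rmorphism laurent -> laurent}) (hbarx : barL xL = xiL).
Variables (bar : vec V -> vec V) (hbar : semilin barL bar).
Variable C : V -> vec V.
Hypothesis Cbar : forall t, bar (C t) = C t.
Hypothesis Cdiag : forall t, C t t = 1.
Hypothesis Clow : forall t u, u != t -> C t u != 0 -> (h u < h t)%N.
Hypothesis Cneg : forall t u, u != t -> negL (C t u).

Definition cphi (y : vec V) : vec V := \sum_u sc (y u) (C u).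

Lemma cphiE y v : cphi y v = \sum_u y u * C u v.
Proof. by rewrite sum_ffunE; apply: eq_bigr => u _; rewrite ffunE. Qed.

Lemma cphi_linear : semilin idL cphi.
Proof.
move=> a m m'; apply/ffunP => v; rewrite ffunE cphiE vec_scE !cphiE mulr_sumr.
rewrite -big_split; apply: eq_bigr => u _ /=.
by rewrite !ffunE mulrDl mulrA.
Qed.

Lemma cphi_ev u : cphi (ev u) = C u.
Proof.
apply/ffunP => v; rewrite cphiE (bigD1 u) //= ffunE eqxx mul1r.
by rewrite big1 ?addr0 // => w /negPf wu; rewrite ffunE wu mul0r.
Qed.

(** A basis vector C_u with u different from v reaches v only if u is strictly higher, where y
    vanishes. *)
Lemma cphi_top (y : vec V) v : (forall u, (h v < h u)%N -> y u = 0) -> cphi y v = y v.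
Proof.
move=> y0; rewrite cphiE (bigD1 v) //= Cdiag mulr1 big1 ?addr0 // => u uv.
have [->|/Clow] := eqVneq (C u v) 0; first by rewrite mulr0.
by rewrite eq_sym => /(_ uv)/y0 ->; rewrite mul0r.
Qed.

Lemma max_support (y : vec V) :
  y != 0 -> exists2 v, y v != 0 & forall u, (h v < h u)%N -> y u = 0.
Proof.
move=> y0; have [u yu|yall] := pickP (fun u => y u != 0); last first.
  by case/eqP: y0; apply/ffunP => u; rewrite ffunE; apply/eqP/negbFE/yall.
case: (@arg_maxnP _ u (fun u => y u != 0) h yu) => v yv vmax; exists v => // w.
by apply: contraTeq => /vmax; rewrite -leqNgt.
Qed.

Lemma cphi_eq0 y : cphi y = 0 -> y = 0.
Proof.
move=> y0; apply/eqP; apply/negPn/negP => /max_support[v yv /cphi_top].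
by rewrite y0 ffunE => yE; rewrite -yE eqxx in yv.
Qed.

Lemma cphi_inj : injective cphi.
Proof.
move=> y y' E; apply/eqP; rewrite -subr_eq0; apply/eqP/cphi_eq0.
by rewrite (semilinD cphi_linear) (semilinN cphi_linear) E subrr.
Qed.

(** Unitriangular elimination: the top layer of heights is removed and induction handles the rest.
    The bound on the support of the coordinates is what [T_can_des] uses. *)
Lemma cphi_surj_below n (m : vec V) : (forall u, (n <= h u)%N -> m u = 0) ->
  exists2 c : vec V, (forall u, (n <= h u)%N -> c u = 0) & cphi c = m.
Proof.
elim: n m => [|n IH] m mlow.
  exists 0 => [u _|]; first by rewrite ffunE.
  by rewrite (semilin0 cphi_linear); apply/ffunP => u; rewrite ffunE mlow.
pose c1 : vec V := [ffun u => if h u == n then m u else 0].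
have c1E u : (n <= h u)%N -> cphi c1 u = m u.
  move=> hu; rewrite cphi_top ?ffunE => [|w hw]; last first.
    by rewrite ffunE; case: eqP => // e; lia.
  by case: eqP => // hn; rewrite mlow //; lia.
have [u hu|c clow cE] := IH (m - cphi c1).
  by rewrite !ffunE c1E // subrr.
exists (c1 + c); last by rewrite (semilinD cphi_linear) cE addrC subrK.
by move=> u hu; rewrite !ffunE clow ?addr0 ?gtn_eqF // ltnW.
Qed.

Lemma cphi_bij : bijective cphi.
Proof.
have surj m : exists c, cphi c == m.
  have [u|c _ <-] := @cphi_surj_below (\max_u h u).+1 m; last by exists c.
  by rewrite ltnNge (leq_bigmax u).
exists (fun m => xchoose (surj m)) => m; last exact/eqP/(xchooseP (surj m)).
by apply: cphi_inj; apply/eqP/(xchooseP (surj (cphi m))).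
Qed.

(** Bar fixes each C_u, so the coordinates of D are bar invariant. A coordinate of maximal height
    equals the entry of D there, which is both bar invariant and in x^-1 Z[x^-1]. *)
Lemma bar_neg_eq0 D : bar D = D -> (forall v, negL (D v)) -> D = 0.
Proof.
case: cphi_bij => g _ gK; rewrite -(gK D); move: (g D) => c {g gK D} cbar cneg.
have bcE : [ffun u => barL (c u)] = c.
  apply: cphi_inj; rewrite -[in RHS]cbar (semilin_lincomb hbar).
  by apply: eq_bigr => u _; rewrite ffunE Cbar.
suff -> : c = 0 by rewrite (semilin0 cphi_linear).
apply/eqP; apply/negPn/negP => /max_support[v cv /cphi_top cE].
move/eqP: cv; apply; apply: (negL_bar_eq0 hbarx); last by rewrite -cE.
by rewrite -[in RHS]bcE ffunE.
Qed.

Lemma coefC t u k : 0 <= k -> coefL (C t u) k = ((u == t) && (k == 0))%:R.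
Proof.
move=> k0; have [->|ut] /= := eqVneq u t; first by rewrite Cdiag coefL1.
exact: Cneg.
Qed.

Lemma bar_expand D : bar D = D -> (forall v k, 0 < k -> coefL (D v) k = 0) ->
  D = \sum_u sc (coefL (D u) 0)%:~R (C u).
Proof.
move=> Dbar Dpos; apply/eqP; rewrite -subr_eq0; apply/eqP/bar_neg_eq0.
  rewrite (semilinD hbar) (semilinN hbar) Dbar (semilin_lincomb hbar).
  by congr (_ - _); apply: eq_bigr => u _; rewrite rmorph_int Cbar.
move=> v k k0; rewrite !ffunE coefLD coefLN sum_ffunE coefL_sum (bigD1 v) //=.
rewrite ffunE coefLZ coefC // eqxx /= big1 ?addr0 => [|u uv]; last first.
  by rewrite ffunE coefLZ coefC // eq_sym (negPf uv) mulr0.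
have [->|kn0] := eqVneq k 0; first by rewrite mulr1 subrr.
by rewrite mulr0 subr0 Dpos // lt0r kn0.
Qed.

(** * One generator acting on the canonical basis *)

Section Generator.
(** T plays H_s, a plays s on the indices, and [neg] marks the level indices with eigenvalue -x^-1.
    The formulas give the entries of T m, so they are transposes of the action on basis vectors.
    [T_bar] says that bar turns T into its inverse. *)
Variables (a : V -> V) (neg : pred V) (T : vec V -> vec V).
Hypothesis aK : involutive a.
Hypothesis a_fix : forall v, h (a v) = h v -> a v = v.
Hypothesis T_linear : semilin idL T.
Hypothesis T_asc : forall m v, (h v < h (a v))%N -> T m v = m (a v).
Hypothesis T_des : forall m v, (h (a v) < h v)%N ->
  T m v = m (a v) + (xL - xiL) * m v.
Hypothesis T_eq : forall m v, h (a v) = h v ->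
  T m v = (if neg v then - xiL else xL) * m v.
Hypothesis TT : forall m, T (T m) = m + sc (xL - xiL) (T m).
Hypothesis T_bar : forall m, T (bar (T m)) = bar m.

Definition is_des v := (h (a v) < h v)%N || ((h (a v) == h v) && ~~ neg v).

Variant step_spec v : bool -> Type :=
 | StepAsc of (h v < h (a v))%N & is_des (a v) :
     step_spec v false
 | StepDes of (h (a v) < h v)%N & is_des (a v) = false :
     step_spec v true
 | StepEqAsc of h (a v) = h v & neg v : step_spec v false
 | StepEqDes of h (a v) = h v & neg v = false : step_spec v true.

Lemma stepP v : step_spec v (is_des v).
Proof.
have E : is_des (a v) = (h v < h (a v))%N || ((h v == h (a v)) && ~~ neg (a v)).
  by rewrite /is_des aK.
have [lt|gt|eq] := ltngtP (h v) (h (a v)).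
- rewrite {1}/is_des ltnNge ltnW //= gtn_eqF //.
  by apply: StepAsc => //; rewrite E lt.
- rewrite {1}/is_des gt /=; apply: StepDes => //.
  by rewrite E ltnNge ltnW //= gtn_eqF.
- rewrite {1}/is_des eq ltnn eqxx /=; case: (boolP (neg v)) => n.
    exact: StepEqAsc.
  by apply: StepEqDes => //; apply/negbTE.
Qed.

(** The action of the Kazhdan-Lusztig element H_s + x^-1: it commutes with bar and, since (T - x)(T
    + x^-1) = 0, maps into the x-eigenspace of T. *)
Definition kl (m : vec V) : vec V := T m + sc xiL m.

Lemma kl_bar m : bar m = m -> bar (kl m) = kl m.
Proof.
move=> mb; rewrite /kl (semilinD hbar) (semilinZ hbar) (barL_xiL hbarx) mb.
have := TT (bar (T m)); rewrite T_bar mb; move: (bar (T m)) => b ->.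
by apply/ffunP => v; rewrite !ffunE; ring.
Qed.

(** This serves twice: positive k gives the bound required by [bar_expand], and k = 0 gives the
    integers in the expansion. *)
Lemma coef_kl_asc t v k : is_des t = false -> 0 <= k ->
  coefL (kl (C t) v) k =
  ((k == 0) && is_des v)%:R * (coefL (C t v) (-1) + (v == a t)%:R).
Proof.
move=> ta k0; rewrite /kl ffunE vec_scE.
case: (stepP v) => [lt dav|lt aav|eq nv|eq nv].
- rewrite T_asc // coefLD coefLMxi andbF mul0r !coefC //; last by lia.
  have -> : (k + 1 == 0) = false by lia.
  by rewrite andbF; case: eqP => // e; rewrite e ta in dav.
- have vt : v != t by apply: contraFneq ta => <-; rewrite /is_des lt.
  rewrite T_des // andbT -[v == a t](inv_eq aK).
  have -> : C t (a v) + (xL - xiL) * C t v + xiL * C t v = C t (a v) + xL * C t v.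
    by ring.
  rewrite coefLD coefLMx coefC //.
  have [->|kn0] := eqVneq k 0; first by rewrite andbT mul1r sub0r addrC.
  by rewrite andbF mul0r Cneg ?addr0 //; lia.
- rewrite T_eq // nv andbF mul0r mulNr.
  by rewrite addNr coefL0.
- have vt : v != t.
    by apply: contraFneq ta => <-; rewrite /is_des eq eqxx nv orbT.
  rewrite T_eq // nv andbT coefLD coefLMx coefLMxi.
  rewrite (Cneg vt (_ : 0 <= k + 1)) ?addr0; last by lia.
  have [->|kn0] := eqVneq k 0.
    rewrite mul1r sub0r; case: eqP => [e|_]; last by rewrite addr0.
    by move/a_fix: eq => av; move: vt; rewrite -av e aK eqxx.
  by rewrite mul0r Cneg //; lia.
Qed.

Lemma kl_asc t : is_des t = false ->
  kl (C t) = \sum_(w | is_des w) sc (coefL (C t w) (-1) + (w == a t)%:R)%:~R (C w).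
Proof.
move=> ta; rewrite [LHS]bar_expand => [||v k k0]; last 2 first.
- by apply: kl_bar.
- by rewrite coef_kl_asc ?ltW // (gt_eqF k0) mul0r.
rewrite [RHS]big_mkcond; apply: eq_bigr => w _; rewrite coef_kl_asc //.
by case: ifP; rewrite ?mul1r // mul0r sc0.
Qed.

(** At a level descent u the entry is 0. At a strict descent it is C_v(au) - x^-1 C_v(u), whose
    constant term would require au = v, while au is an ascent. At an ascent u differs from v, so
    multiplying C_v(u) by x reaches exponent 0 at most. *)
Lemma coef_Tx_des v u k : is_des v -> 0 <= k -> (0 < k) || is_des u ->
  coefL ((T (C v) - sc xL (C v)) u) k = 0.
Proof.
move=> dv k0; rewrite ffunE ffunE vec_scE.
case: (stepP u) => [lt dau|lt aau|eq nu|eq nu] ku.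
- have kp : 0 < k by rewrite orbF in ku.
  have uv : u != v.
    by apply: contraTneq dv => <-; rewrite /is_des ltnNge ltnW //= gtn_eqF.
  rewrite T_asc // coefLD coefLN coefLMx coefC // (gt_eqF kp) andbF sub0r.
  by rewrite Cneg ?oppr0 //; lia.
- have -> : T (C v) u - xL * C v u = C v (a u) - xiL * C v u.
    by rewrite T_des //; ring.
  rewrite coefLD coefLN coefLMxi !coefC //; last by lia.
  have -> : (k + 1 == 0) = false by lia.
  by rewrite andbF subr0; case: eqP => // e; rewrite e dv in aau.
- have kp : 0 < k by rewrite orbF in ku.
  have uv : u != v.
    by apply: contraTneq dv => <-; rewrite /is_des eq ltnn eqxx nu.
  rewrite T_eq // nu mulNr !(coefLD, coefLN, coefLMx, coefLMxi) !Cneg ?oppr0 ?addr0 //; lia.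
- by rewrite T_eq // nu subrr coefL0.
Qed.

Lemma T_kl m : T (kl m) = sc xL (kl m).
Proof.
rewrite /kl (semilinD T_linear) (semilinZ T_linear) TT; apply/ffunP => u.
by rewrite !ffunE /idL /= -[in LHS](mul1r (m u)) -xLxiL; ring.
Qed.

(** At a strict descent take M_v + x^-1 M_(av), which is [kl] applied to M_(av); at a level descent
    M_v itself is an eigenvector. *)
Lemma eigen_lead v : is_des v -> exists N : vec V,
  [/\ T N = sc xL N, N v = 1 & forall u, u != v -> (h v <= h u)%N -> N u = 0].
Proof.
case: stepP => // [lt _|eq nv] _.
  exists (kl (ev (a v))); split; first exact: T_kl.
    have /negPf vav : v != a v by apply: contraTneq lt => <-; rewrite ltnn.
    by rewrite !ffunE T_des // !ffunE eqxx vav !mulr0 !addr0.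
  move=> u /negPf uv hu.
  have /negPf uav : u != a v by apply: contraTneq hu => ->; rewrite -ltnNge.
  rewrite ffunE vec_scE; case: (stepP u) => *.
  - by rewrite T_asc // !ffunE (inj_eq (inv_inj aK)) uv uav mulr0 addr0.
  - by rewrite T_des // !ffunE (inj_eq (inv_inj aK)) uv uav !mulr0 !addr0.
  - by rewrite T_eq // !ffunE uav !mulr0 addr0.
  - by rewrite T_eq // !ffunE uav !mulr0 addr0.
exists (ev v); split => [||u /negPf uv _]; last 2 first.
- by rewrite ffunE eqxx.
- by rewrite ffunE uv.
have auE u : (a u == v) = (u == v) by rewrite -{1}(a_fix eq) (inj_eq (inv_inj aK)).
apply/ffunP => u; rewrite vec_scE; have [->|/negPf uv] := eqVneq u v.
  by rewrite T_eq // nv.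
case: (stepP u) => *.
- by rewrite T_asc // !ffunE auE uv mulr0.
- by rewrite T_des // !ffunE auE uv !mulr0 addr0.
- by rewrite T_eq // !ffunE uv !mulr0.
- by rewrite T_eq // !ffunE uv !mulr0.
Qed.

(* Write N = C v + \sum_u c_u C u for an eigenvector N as in eigen_lead. An   *)
(* ascent u contributes an integer multiple a_u C u to (T - x) (C v), and      *)
(* (T - x) N = 0 gives a_u = (x + x^-1) c_u, whence a_u = 0.                   *)
Lemma T_can_des v : is_des v -> T (C v) = sc xL (C v).
Proof.
have [n] := ubnP (h v); elim: n v => // n IH v hv dv.
pose E m : vec V := T m - sc xL m.
have Elin : semilin idL E.
  by move=> c m m'; rewrite /E T_linear; apply/ffunP => u; rewrite !ffunE /idL /=; ring.
have [g cK gK] := cphi_bij.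
have glin : semilin idL g.
  by move=> c m m'; apply: cphi_inj; rewrite cphi_linear !gK.
have gC u : g (C u) = ev u by rewrite -cphi_ev cK.
(* For an ascent w, (T - x) C_w is -(x + x^-1) C_w plus the combination of descents from [kl_asc],
   so its ascent coordinates are visible. *)
have gE w u : is_des w = false -> is_des u = false ->
    g (E (C w)) u = - (xL + xiL) * (u == w)%:R.
  move=> dw du; have -> : E (C w) = sc (- (xL + xiL)) (C w) + kl (C w).
    by apply/ffunP => z; rewrite !ffunE; ring.
  rewrite glin gC kl_asc // (semilin_lincomb glin) !ffunE sum_ffunE.
  rewrite big1 ?addr0 // => z dz.
  rewrite gC !ffunE; case: (u =P z) => [e|_]; last by rewrite mulr0.
  by rewrite -e du in dz.
have [N [TN Nv Nlow]] := eigen_lead dv.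
have [u hu|c clow cE] := @cphi_surj_below (h v) (N - C v).
  rewrite !ffunE; have [->|uv] := eqVneq u v; first by rewrite Nv Cdiag subrr.
  rewrite Nlow // sub0r; apply/eqP; rewrite oppr_eq0; apply: contraTT hu.
  by rewrite -ltnNge; apply: Clow.
pose al u := coefL (E (C v) u) 0.
have EvE : E (C v) = \sum_u sc (al u)%:~R (C u).
  apply: bar_expand => [|u k k0]; last by rewrite coef_Tx_des ?ltW // k0.
  have -> : E (C v) = kl (C v) - sc (xL + xiL) (C v).
    by apply/ffunP => u; rewrite !ffunE; ring.
  rewrite (semilinD hbar) (semilinN hbar) (semilinZ hbar) Cbar kl_bar //.
  by rewrite rmorphD hbarx (barL_xiL hbarx) addrC [xiL + _]addrC addrC.
suff al0 u : (al u)%:~R = 0 :> laurent.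
  apply/eqP; rewrite -subr_eq0 -/(E (C v)) EvE big1 // => u _.
  by rewrite al0 sc0.
case du: (is_des u); first by rewrite /al coef_Tx_des // du orbT.
suff E2 : (xL + xiL) * c u = (al u)%:~R by rewrite -E2 (quantum2_int E2) mulr0.
(* Coordinate u of (T - x) N = 0. Among the lower C_w, descents vanish by induction on the height,
   and ascents contribute only through w = u. *)
have /(congr1 (fun m => g (E m) u)) : N = C v + cphi c by rewrite cE addrC subrK.
rewrite (semilinD Elin) (semilin_lincomb Elin) (semilinD glin).
rewrite EvE !(semilin_lincomb glin) /E TN subrr (semilin0 glin).
rewrite 2!ffunE !sum_ffunE (bigD1 u) //= gC !ffunE eqxx mulr1 big1 => [|w wu]; last first.
  by rewrite gC !ffunE eq_sym (negPf wu) mulr0.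
rewrite addr0 (bigD1 u) //= big1 => [|w wu]; last first.
  rewrite ffunE; have [hw|hw] := leqP (h v) (h w); first by rewrite clow ?mul0r.
  case dw: (is_des w).
    by rewrite IH //; last (by lia); rewrite subrr (semilin0 glin) ffunE mulr0.
  by rewrite gE ?dw // eq_sym (negPf wu) !mulr0.
rewrite ffunE gE // eqxx addr0 /idL /= mulr1 mulrN => /esym/eqP.
by rewrite subr_eq0 => /eqP ->; rewrite mulrC.
Qed.

(** Compare entries at t in T C_v = x C_v. At a strict ascent, C_v(at) = x C_v(t), and the constant
    term on the left is known. At a level one, (x + x^-1) C_v(t) = 0. *)
Lemma mu_asc_des t v : is_des t = false -> is_des v ->
  coefL (C v t) (-1) = (v == a t)%:R.
Proof.
move=> ta dv; have /(congr1 (fun m : vec V => m t)) := T_can_des dv.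
rewrite vec_scE; move: ta; case: (stepP t) => // [lt _|eq nt] _.
  rewrite T_asc // => /(congr1 (coefL^~ 0)).
  by rewrite coefLMx coefC // andbT sub0r [a t == v]eq_sym => <-.
rewrite T_eq // nt mulNr => /eqP; rewrite eq_sym -addr_eq0 -mulrDl => /eqP e.
rewrite (quantum2_int (e : _ = 0%:~R)) coefL0 (a_fix eq).
case: eqP => // vt; move: dv.
by rewrite vt /is_des eq ltnn eqxx nt.
Qed.

Lemma T_can_asc t : is_des t = false ->
  T (C t) = sc (- xiL) (C t) +
    \sum_(w | is_des w) sc (coefL (C t w) (-1) + coefL (C w t) (-1))%:~R (C w).
Proof.
move=> ta; have -> : T (C t) = sc (- xiL) (C t) + kl (C t).
  by apply/ffunP => u; rewrite !ffunE; ring.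
by rewrite kl_asc //; congr (_ + _); apply: eq_bigr => w dw; rewrite (mu_asc_des ta).
Qed.

(** By [kl_asc], C_(at) is [kl] of C_t minus multiples of C_w with w below t. A nonzero multiple is
    a coefficient of x^-1 in C_t(w), so the heights of w and t differ by an odd number and C_w has
    the parity of C_(at). *)
Lemma parity_step t : (h (a t) = (h t).+1) ->
  (forall v, (h (a v) <= (h v).+1)%N) ->
  (forall u, parL (C t u) (h t + h u)) ->
  (forall w, (h w < h t)%N -> forall u, parL (C w u) (h w + h u)) ->
  forall u, parL (C (a t) u) (h (a t) + h u).
Proof.
move=> hat hstep part parw u.
have [ta dat] : is_des t = false /\ is_des (a t).
  by case: (stepP t) => //; lia.
have := kl_asc ta; rewrite (bigD1 (a t)) //= eqxx.
(* Since at is higher than t, C_t has no entry there, and C_(at) occurs with coefficient exactly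
   1. *)
have -> : coefL (C t (a t)) (-1) = 0.
  have [->|/Clow] := eqVneq (C t (a t)) 0; first by rewrite coefL0.
  case: eqP => [e|_ /(_ isT)]; last by lia.
  by have := congr1 h e; rewrite hat; lia.
rewrite add0r sc1; set R := (X in _ = _ + X) => klE.
have -> : C (a t) = kl (C t) - R by rewrite klE addrK.
rewrite !ffunE sum_ffunE -sumrN; apply: parLD; last first.
  apply: parL_sum => w /andP[_ /negPf wat]; rewrite wat addr0 vec_scE -mulNr -mulrNz.
  have [->|mu] := eqVneq (coefL (C t w) (-1)) 0; first by rewrite oppr0 mul0r; exact: parL0.
  have wt : w != t.
    by apply: contra_neq mu => ->; rewrite Cdiag coefL1.
  have hw : (h w < h t)%N.
    by apply: Clow => //; apply: contra_neq mu => ->; rewrite coefL0.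
  have := part w _ mu => po.
  apply: parLZ; apply: (parL_congr _ (parw w hw u)); move: po; rewrite hat; lia.
have pa : h (a u) <> h u -> parL (C t (a u)) (h (a t) + h u).
  move=> ne; apply: (parL_congr _ (part (a u))); rewrite hat.
  by have := hstep u; have := hstep (a u); rewrite aK; lia.
have pxi : parL (xiL * C t u) (h (a t) + h u) by rewrite hat addSn; exact: parLMxi.
have px : parL (xL * C t u) (h (a t) + h u) by rewrite hat addSn; exact: parLMx.
case: (stepP u) => [lt _|lt _|eq nu|eq nu].
- by rewrite T_asc //; apply: parLD => //; apply: pa; lia.
- rewrite T_des //.
  have -> : C t (a u) + (xL - xiL) * C t u + xiL * C t u = C t (a u) + xL * C t u.
    by ring.
  by apply: parLD => //; apply: pa; lia.
- by rewrite T_eq // nu mulNr addNr; exact: parL0.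
- by rewrite T_eq // nu; apply: parLD.
Qed.

End Generator.
End CanonicalBasis.

(** * Length functions *)

Section Length.
Variables (gT : finGroupType) (S : {set gT}).
Local Open Scope group_scope.
Implicit Types (w s : gT) (ws : seq gT).

Lemma prodw_cat ws ws' : prodw (ws ++ ws') = prodw ws * prodw ws'.
Proof. by rewrite /prodw big_cat. Qed.

Lemma prodw_cons s ws : prodw (s :: ws) = s * prodw ws.
Proof. by rewrite /prodw big_cons. Qed.

Lemma prodw1 s : prodw [:: s] = s.
Proof. by rewrite /prodw big_seq1. Qed.

Lemma prodw_gen ws : all (mem S) ws -> prodw ws \in <<S>>.
Proof.
elim: ws => [|s ws IH] /=; first by rewrite /prodw big_nil group1.
by case/andP=> sS /IH wsS; rewrite prodw_cons groupM // mem_gen.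
Qed.

Lemma wordsetP n w :
  reflect (exists ws, [/\ all (mem S) ws, size ws = n & prodw ws = w])
          (w \in wordset S n).
Proof.
elim: n w => [|n IH] w /=.
  rewrite inE; apply: (iffP eqP) => [->|[ws [_ /size0nil -> <-]]].
    by exists [::]; rewrite /prodw big_nil.
  by rewrite /prodw big_nil.
apply: (iffP imset2P) => [[v s /IH[ws [wsS <- <-]] sS ->]|[ws [wsS]]].
  exists (rcons ws s); rewrite all_rcons size_rcons /= sS; split => //.
  by rewrite -cats1 prodw_cat prodw1.
case/lastP: ws wsS => // ws s; rewrite all_rcons size_rcons => /andP[sS wsS] [sz].
rewrite -cats1 prodw_cat prodw1 => <-; apply: Imset2spec sS _ => //.
by apply/IH; exists ws.
Qed.

Lemma len_le ws : all (mem S) ws -> (len S (prodw ws) <= size ws)%N.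
Proof.
move=> wsS; rewrite leqNgt; apply/negP => lt.
have := before_find 0%N lt; rewrite nth_iota; last first.
  by apply: leq_trans lt _; rewrite -[X in (_ <= X)%N](size_iota 0); exact: find_size.
by case/negP; apply/wordsetP; exists ws.
Qed.

(* The prefixes of a shortest word are pairwise distinct, so that its size is *)
(* within the search range of len.                                           *)
Lemma reduced_word w : w \in <<S>> ->
  exists ws, [/\ all (mem S) ws, prodw ws = w & len S w = size ws].
Proof.
case/gen_prodgP => m [c cS wE].
have ex : exists n, w \in wordset S n.
  exists m; apply/wordsetP; exists [seq c i | i <- index_enum 'I_m]; split.
  - by apply/allP => _ /mapP[i _ ->]; exact: cS.
  - by rewrite size_map [index_enum _]unlock -enumT size_enum_ord.
  - by rewrite wE /prodw big_map.
case: (ex_minnP ex) => n /wordsetP[ws [wsS szn wsw]] nmin.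
have inj : injective (fun i : 'I_n.+1 => prodw (take i ws)).
  suff H (i j : nat) : (i < j)%N -> (j <= n)%N -> prodw (take i ws) <> prodw (take j ws).
    move=> i j e; apply/val_inj; have [lt|lt|//] := ltngtP (val i) (val j).
      by case: (H i j lt (ltn_ord j)).
    by case: (H j i lt (ltn_ord i)).
  move=> ij jn e.
  have : w \in wordset S (i + (n - j)).
    apply/wordsetP; exists (take i ws ++ drop j ws); split.
    - rewrite all_cat; apply/andP; split; apply/allP => x.
        by move=> /mem_take/(allP wsS).
      by move=> /mem_drop/(allP wsS).
    - by rewrite size_cat size_drop szn size_takel //; lia.
    - by rewrite prodw_cat e -prodw_cat cat_take_drop.
  by move/nmin; lia.
have := leq_card _ inj; rewrite card_ord => ncard.
have hs : has (fun n => w \in wordset S n) (iota 0 #|gT|.+1).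
  apply/hasP; exists n; first by rewrite mem_iota /= add0n ltnS; exact: ltnW.
  by apply/wordsetP; exists ws.
have := nth_find 0%N hs; rewrite has_find size_iota in hs.
rewrite nth_iota // => /wordsetP[ws' [ws'S sz ws'w]].
by exists ws'; split; rewrite // sz.
Qed.

Hypothesis S2 : {in S, forall s, s * s = 1}.

Lemma genS_inv s : s \in S -> s^-1 = s.
Proof. by move=> sS; apply: (mulgI s); rewrite mulgV S2. Qed.

Lemma len1 : len S 1 = 0%N.
Proof. by have := @len_le [::] isT; rewrite /prodw big_nil leqn0 => /eqP. Qed.

Lemma len_mul_le s w : s \in S -> w \in <<S>> -> (len S (s * w) <= (len S w).+1)%N.
Proof.
move=> sS /reduced_word[ws [wsS <- ->]]; rewrite -prodw_cons.
by apply: (@len_le (s :: ws)); rewrite /= sS.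
Qed.

Lemma len_mul_ge s w : s \in S -> w \in <<S>> -> (len S w <= (len S (s * w)).+1)%N.
Proof.
move=> sS wW; rewrite -{1}[w](mulKg s) genS_inv //.
by apply: len_mul_le => //; rewrite groupM // mem_gen.
Qed.

Lemma len_inv_le w : w \in <<S>> -> (len S w^-1 <= len S w)%N.
Proof.
move=> /reduced_word[ws [wsS <- ->]].
have -> : (prodw ws)^-1 = prodw (rev ws).
  elim: ws wsS => [|s ws IH] /=; first by rewrite /prodw big_nil invg1.
  case/andP=> sS /IH E; rewrite rev_cons -cats1 prodw_cat prodw1 prodw_cons invMg E.
  by rewrite genS_inv.
by rewrite -(size_rev ws) len_le // all_rev.
Qed.

Lemma lenV w : w \in <<S>> -> len S w^-1 = len S w.
Proof.
move=> wW; apply/eqP; rewrite eqn_leq len_inv_le //= -{1}[w]invgK.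
by rewrite len_inv_le // groupV.
Qed.

Lemma lenMV w s : s \in S -> w \in <<S>> -> len S (w * s) = len S (s * w^-1).
Proof.
move=> sS wW; have wsW : w * s \in <<S>> by rewrite groupM // mem_gen.
by rewrite -(lenV wsW) invMg (genS_inv sS).
Qed.

Lemma len_mulr_le w s : s \in S -> w \in <<S>> -> (len S (w * s) <= (len S w).+1)%N.
Proof. by move=> sS wW; rewrite lenMV // -(lenV wW) len_mul_le // groupV. Qed.

Lemma len_mulr_ge w s : s \in S -> w \in <<S>> -> (len S w <= (len S (w * s)).+1)%N.
Proof. by move=> sS wW; rewrite lenMV // -(lenV wW) len_mul_ge // groupV. Qed.

(** A suffix of a reduced word is reduced, so peeling off first letters always lowers the length. *)
Lemma length_ind (P : gT -> Prop) : P 1 ->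
  (forall s w, s \in S -> w \in <<S>> -> (len S w < len S (s * w))%N -> P w -> P (s * w)) ->
  forall w, w \in <<S>> -> P w.
Proof.
move=> P1 PS w /reduced_word[ws [wsS <-]].
elim: ws wsS => [|s ws IH] /=; first by rewrite /prodw big_nil.
case/andP=> sS wsS; rewrite prodw_cons => sz; have wW := prodw_gen wsS.
have le := len_le wsS; have := len_mul_le sS wW => le'.
by apply: PS => //; [lia | apply: IH => //; lia].
Qed.

End Length.

(** * Consequences of a Hecke module structure *)

Section Hecke.
Variables (gT : finGroupType) (W S : {set gT}) (V : finType).
Hypothesis WS : W = <<S>>%g.
Hypothesis S2 : {in S, forall s, s * s = 1}%g.
Variable rho : gT -> vec V -> vec V.
Hypothesis rhoH : hecke_rep W S rho.

Lemma genS_W s : s \in S -> s \in W.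
Proof. by move=> sS; rewrite WS mem_gen. Qed.

Lemma hecke_linear w : w \in W -> semilin idL (rho w).
Proof. by case: rhoH => H _ _ wW a m m'; apply: H. Qed.

Lemma hecke_quadratic s m : s \in S ->
  rho s (rho s m) = m + sc (xL - xiL) (rho s m).
Proof.
case: rhoH => _ H1 HS sS; rewrite (HS s s) ?genS_W // S2 // (len1 S) ltn0.
by rewrite H1.
Qed.

Lemma hecke_mul s w m : s \in S -> w \in W -> (len S w < len S (s * w)%g)%N ->
  rho (s * w)%g m = rho s (rho w m).
Proof. by case: rhoH => _ _ HS sS wW lt; rewrite HS // lt. Qed.

(** The quadratic relation makes each H_s injective, and H_w is a product of such operators along a
    reduced word. *)
Lemma hecke_eq0 w m : w \in W -> rho w m = 0 -> m = 0.
Proof.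
rewrite WS => wW; elim/length_ind: w / wW m => [m|s w sS wW lt IH m].
  by case: rhoH => _ ->.
rewrite hecke_mul ?WS // => e; apply: IH; move: (rho w m) e => {}m e.
have := hecke_quadratic m sS; rewrite e (semilin0 (hecke_linear (genS_W sS))).
by move/esym/eqP; rewrite addr_eq0 => /eqP ->; apply/ffunP => u; rewrite !ffunE mulr0 oppr0.
Qed.

(* The exchange condition of coxeter_system does not exclude l(sw) = l(w), as *)
(* shown by the three involutions of the Klein group; the existence of a      *)
(* nonzero Hecke module does.                                                 *)
Lemma len_mul_neq (v0 : V) s w : s \in S -> w \in W -> len S (s * w)%g != len S w.
Proof.
move=> sS wW; apply/eqP => e.
have swW : (s * w)%g \in W by move: wW; rewrite WS => wW; rewrite groupM // mem_gen.
have ssw : (s * (s * w) = w)%g by rewrite mulgA S2 // mul1g.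
have [_ _ HS] := rhoH; pose m := ev v0.
have := hecke_quadratic (rho w m) sS.
rewrite [in LHS](HS s w sS wW m) e ltnn (semilinD (hecke_linear (genS_W sS))).
rewrite (semilinZ (hecke_linear (genS_W sS))) (HS s _ sS swW) ssw e ltnn => E.
(* With equal lengths, both H_s H_w and H_s H_(sw) fall in the second branch. The quadratic relation
   then leaves (x - x^-1) H_(sw) m = 0. *)
have /hecke_eq0 : rho (s * w)%g m = 0.
  apply/ffunP => u; rewrite ffunE; apply: (laurent_mulf_eq0 _ xL_sub_xiL_neq0).
  have /ffunP/(_ u) := E; rewrite !ffunE /idL /= => /eqP; rewrite -subr_eq0 => /eqP <-.
  ring.
move/(_ swW)/ffunP/(_ v0)/eqP; rewrite !ffunE eqxx.
by rewrite oner_eq0.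
Qed.

End Hecke.

(** * Heights *)

Section Height.
Variables (gT : finGroupType) (W : {group gT}) (S J : {set gT}).
Hypothesis hcox : coxeter_system W S.
Hypothesis JS : J \subset S.
Hypothesis lenS : forall s w, s \in S -> w \in W -> len S (s * w)%g != len S w.
Local Open Scope group_scope.

Let WS : (W : {set gT}) = <<S>>. Proof. by case: hcox. Qed.
Let S2 : {in S, forall s, s * s = 1}. Proof. by case: hcox. Qed.

(** Deodhar's lemma. If t in J does not lengthen sw, then s shortens wt, so the exchange condition
    deletes a letter from a reduced word of w followed by t. *)
Lemma deodhar w s : w \in WJ W S J -> s \in S -> s * w \notin WJ W S J ->
  w^-1 * s * w \in J.
Proof.
rewrite !inE => /andP[wW /forall_inP wJ] sS.
have wG : w \in <<S>> by rewrite -WS.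
have swG : s * w \in <<S>> by rewrite groupM // mem_gen.
rewrite WS swG /= negb_forall_in => /exists_inP[t tJ]; rewrite -leqNgt => swt.
have tS := subsetP JS t tJ.
have wt : (len S w < len S (w * t))%N := wJ t tJ.
have {}swt : (len S (s * w * t) <= len S (s * w))%N := swt.
have wtle := len_mulr_le S2 tS wG; have swle := len_mul_le sS wG.
have := len_mul_ge S2 sS (groupM wG (mem_gen tS)); rewrite mulgA => swtge.
have ne : len S (s * w * t) != len S (s * w).
  rewrite (lenMV S2) // -(lenV S2 swG).
  by apply: lenS => //; rewrite groupV WS.
have lt : (len S (s * w * t) < len S (w * t))%N.
  apply: leq_ltn_trans wt; rewrite -ltnS; apply: leq_trans swle.
  by rewrite ltn_neqAle ne.
have [ws [wsS wsw wsl]] := reduced_word wG.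
have [_ _ _ exch] := hcox.
have wtE : prodw (ws ++ [:: t]) = w * t by rewrite prodw_cat prodw1 wsw.
case: (exch s (ws ++ [:: t]) sS).
- by rewrite all_cat wsS /= tS.
- by apply/eqP; rewrite wtE size_cat addn1 -wsl eqn_leq wtle.
- by rewrite wtE size_cat mulgA addn1 -wsl; apply: leq_trans lt wtle.
(* Deleting the final t gives swt = w, hence w^-1 s w = t. Deleting a letter of w would make sw
   shorter than w, against the length bounds above. *)
move=> i; rewrite size_cat /= addn1 ltnS wtE mulgA leq_eqVlt => /orP[/eqP -> E|il E].
  have {}E : s * w * t = w.
    by move: E; rewrite take_size_cat // drop_oversize ?cats0 ?wsw // size_cat addn1.
  suff -> : w^-1 * s * w = t by [].
  by apply: (mulgI w); rewrite !mulgA mulgV mul1g -{2}E -mulgA S2 // mulg1.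
have dropE : drop i.+1 (ws ++ [:: t]) = drop i.+1 ws ++ [:: t].
  rewrite drop_cat; case: ltnP => // h; rewrite (drop_oversize h).
  by have -> : (i.+1 - size ws = 0)%N by lia.
move: E; rewrite take_cat il dropE catA prodw_cat prodw1 => /mulIg swE.
have : (len S (s * w) <= size (take i ws ++ drop i.+1 ws))%N.
  rewrite swE; apply: len_le; rewrite all_cat; apply/andP; split; apply/allP => x.
    by move=> /mem_take/(allP wsS).
  by move=> /mem_drop/(allP wsS).
rewrite size_cat size_take il size_drop => le.
have : (len S w <= len S (s * w))%N.
  by apply: leq_trans swt; rewrite -ltnS; exact: leq_trans wt swtge.
rewrite wsl => /leq_trans/(_ le); move: (size ws) il => n il; lia.
Qed.

Lemma Aut_genJ (f : {perm gT}) : f \in AutJ J ->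
  {in <<J>> &, {morph f : x y / x * y}}.
Proof. by rewrite inE => /andP[/Aut_morphic/morphicP]. Qed.

Lemma AutJ_mem (f : {perm gT}) t : f \in AutJ J -> t \in J -> f t \in J.
Proof. by rewrite inE => /andP[_ /eqP fJ] tJ; rewrite -fJ imset_f. Qed.

Lemma IJ_inWpJ z : z \in IJ J -> inWpJ J z.
Proof. by rewrite inE => /and3P[]. Qed.

Lemma conjP_actJ t z : z.2 \in AutJ J -> t \in J -> conjP t z = actJ t z.
Proof.
move=> zA tJ; rewrite /conjP /actJ /mulP /= !perm1 mul1g mulg1; congr (_ * _, _).
by rewrite (genS_inv S2) // (subsetP JS) // AutJ_mem.
Qed.

Lemma actJM u v z : z.2 \in AutJ J -> u \in <<J>> -> v \in <<J>> ->
  actJ u (actJ v z) = actJ (u * v) z.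
Proof.
by move=> zA uJ vJ; rewrite /actJ /= (Aut_genJ zA) // invMg !mulgA.
Qed.

Lemma orbit_actJ v z : z.2 \in AutJ J -> v \in <<J>> ->
  [set actJ u (actJ v z) | u in <<J>>] = [set actJ u z | u in <<J>>].
Proof.
move=> zA vJ; apply/setP => y; apply/imsetP/imsetP => -[u uJ ->].
  by exists (u * v); rewrite ?groupM // actJM.
by exists (u * v^-1); rewrite ?groupM ?groupV // actJM ?groupM ?groupV // mulgKV.
Qed.

(** Both picks range over the same orbit. A shortest element of the orbit is minimal, so the pick
    succeeds and the default of [odflt], which would depend on z, is never reached. *)
Lemma zmin_conjP t z : z.2 \in AutJ J -> t \in J ->
  zmin S J (conjP t z) = zmin S J z.
Proof.
move=> zA tJ; rewrite conjP_actJ // /zmin orbit_actJ ?mem_gen //.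
case: pickP => // none; exfalso.
pose O := [set actJ u z | u in <<J>>].
have zO : z \in O.
  apply/imsetP; exists 1; rewrite ?group1 //; rewrite /actJ mul1g.
  have -> : z.2 1 = 1.
    by apply: (mulgI (z.2 1)); rewrite -(Aut_genJ zA) ?group1 // !mulg1.
  by rewrite invg1 mulg1; case: (z).
case: (@arg_minnP _ z (mem O) (fun y => len S y.1) zO) => y yO ymin.
have /negP := none y; apply; apply/andP; split=> //; apply/forall_inP => s sJ.
apply: ymin; case/imsetP: yO => u uJ ->.
have : actJ (s * u) z \in O by apply: imset_f; rewrite groupM // mem_gen.
by rewrite conjP_actJ // actJM // mem_gen.
Qed.

Lemma len_conjP t z : inWpJ J z -> t \in J ->
  (len S (conjP t z).1 <= len S z.1 + 2)%N /\ (len S z.1 <= len S (conjP t z).1 + 2)%N.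
Proof.
case/andP=> zJ zA tJ.
have -> : (conjP t z).1 = t * z.1 * z.2 t by rewrite /conjP /mulP /= perm1 mulg1.
have tS := subsetP JS t tJ; have ztS := subsetP JS _ (AutJ_mem zA tJ).
have zS : z.1 \in <<S>> by apply: subsetP zJ; exact: genS.
have tzS : t * z.1 \in <<S>> by rewrite groupM // mem_gen.
have := len_mul_le tS zS; have := len_mul_ge S2 tS zS.
have := len_mulr_le S2 ztS tzS; have := len_mulr_ge S2 ztS tzS.
move: (len S z.1) (len S (t * z.1)) (len S (t * z.1 * z.2 t)) => a b c; lia.
Qed.

(** Either the length of w grows by at most one, or z is conjugated by an element of J: the minimal
    element stays, the length of z grows by at most two, and [ht] halves it. *)
Lemma ht_step s tau : s \in S -> tau \in Kset W S J ->
  (ht S J (Defs.actK W S J s tau) <= (ht S J tau).+1)%N.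
Proof.
case: tau => w z sS; rewrite inE /= => /andP[wWJ zI].
have wS : w \in <<S>> by move: wWJ; rewrite inE -WS => /andP[].
have /andP[zJ zA] := IJ_inWpJ zI.
rewrite /Defs.actK /=; case: ifP => [_|/negbT swn]; rewrite /ht /=.
  by have := len_mul_le sS wS; lia.
have tJ := deodhar wWJ sS swn; rewrite zmin_conjP //.
have [le _] := len_conjP (IJ_inWpJ zI) tJ; rewrite -addnS leq_add2l.
move: le => /=; move: (len S z.1) (len S (zmin S J z).1) => a b.
by move: (len S _) => c; lia.
Qed.

End Height.

(** * The module on [KT W S J] *)

Section PerfectModel.
Variables (gT : finGroupType) (W : {group gT}) (S J : {set gT}).
Hypothesis hcox : coxeter_system W S.
Hypothesis JS : J \subset S.
Variable sigma : gT -> int.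
Variable rhoM : gT -> vec (KT W S J) -> vec (KT W S J).
Hypothesis hrhoM : hecke_rep W S rhoM.
Hypothesis hrhoMs : forall s, s \in S -> forall m, rhoM s m = opM W S J sigma s m.

Let WS : (W : {set gT}) = <<S>>%g. Proof. by case: hcox. Qed.
Let S2 : {in S, forall s, s * s = 1}%g. Proof. by case: hcox. Qed.

Definition htK (u : KT W S J) : nat := ht S J (val u).

(** When s keeps the height, H_s acts on the basis vector by a scalar even if s moves the index.
    Fixing the index there gives the property [a_fix] of the abstract setting. The default of
    [insubd] is excluded by [actK_closed]. *)
Definition stepK (s : gT) (u : KT W S J) : KT W S J :=
  if ht S J (Defs.actK W S J s (val u)) == htK u then u
  else insubd u (Defs.actK W S J s (val u)).

Lemma evK_val (u : KT W S J) : evK W S J (val u) = ev u.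
Proof. by apply/ffunP => v; rewrite !ffunE. Qed.

Lemma evK_notin x : x \notin Kset W S J -> evK W S J x = 0.
Proof.
move=> xK; apply/ffunP => v; rewrite !ffunE; case: eqP => // e.
by rewrite -e (valP v) in xK.
Qed.

Lemma opM_ev s u : opM W S J sigma s (ev u) = imgM W S J sigma s (val u).
Proof.
rewrite /opM (bigD1 u) //= ffunE eqxx sc1 big1 ?addr0 // => v /negPf vu.
by rewrite ffunE vu sc0.
Qed.

Lemma imgM_quadratic s u : s \in S ->
  opM W S J sigma s (imgM W S J sigma s (val u)) =
  ev u + sc (xL - xiL) (imgM W S J sigma s (val u)).
Proof.
move=> sS; rewrite -opM_ev -!hrhoMs //.
exact: (hecke_quadratic WS S2 hrhoM).
Qed.

Lemma opM_linear s : s \in S -> semilin idL (opM W S J sigma s).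
Proof.
move=> sS a m m'; rewrite -!hrhoMs //.
by apply: (hecke_linear hrhoM); rewrite WS mem_gen.
Qed.

Lemma ev_neq0 (V : finType) (u : V) : ev u != 0 :> vec V.
Proof. by apply/eqP => /ffunP/(_ u)/eqP; rewrite !ffunE eqxx oner_eq0. Qed.

Lemma imgM_asc s u : (htK u < ht S J (Defs.actK W S J s (val u)))%N ->
  imgM W S J sigma s (val u) = evK W S J (Defs.actK W S J s (val u)).
Proof. by rewrite /imgM /htK => ->. Qed.

Lemma imgM_des s u : (ht S J (Defs.actK W S J s (val u)) < htK u)%N ->
  imgM W S J sigma s (val u) =
  evK W S J (Defs.actK W S J s (val u)) + sc (xL - xiL) (ev u).
Proof. by rewrite /imgM /htK => lt; rewrite ltnNge ltnW //= lt evK_val. Qed.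

Lemma imgM_eq s u : ht S J (Defs.actK W S J s (val u)) = htK u ->
  imgM W S J sigma s (val u) =
  sc (if sgnK sigma s (val u) == -1 then - xiL else xL) (ev u).
Proof. by rewrite /imgM /htK => ->; rewrite ltnn evK_val; case: ifP. Qed.

(* Stability of the basis under s, and s being an involution on it, are forced *)
(* by the quadratic relation of H_s.                                           *)
Lemma actK_closed s u : s \in S ->
  ht S J (Defs.actK W S J s (val u)) != htK u ->
  Defs.actK W S J s (val u) \in Kset W S J.
Proof.
move=> sS; have := imgM_quadratic u sS; have lin := opM_linear sS.
have [lt|lt|//] := ltngtP (ht S J (Defs.actK W S J s (val u))) (htK u).
  rewrite imgM_des // => E _; apply: contraT => /evK_notin e0; move: E.
  rewrite e0 add0r (semilinZ lin) opM_ev imgM_des // e0 add0r => /esym/eqP.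
  by rewrite -subr_eq0 addrK (negPf (ev_neq0 _)).
rewrite imgM_asc // => E _; apply: contraT => /evK_notin e0; move: E.
rewrite e0 (semilin0 lin) => /ffunP/(_ u); rewrite !ffunE eqxx mulr0 addr0.
by move/eqP; rewrite eq_sym oner_eq0.
Qed.

Lemma actK_invol s (u w : KT W S J) : s \in S -> val w = Defs.actK W S J s (val u) ->
  htK w != htK u -> Defs.actK W S J s (val w) = val u.
Proof.
move=> sS wE ne; have wu : w != u by apply: contraNneq ne => ->.
have lin := opM_linear sS.
have uw : u == w = false by rewrite eq_sym; apply/negbTE.
(* The quadratic relation at M_u puts coefficient 1 on M_u in H_s M_w. As u differs from w, only the
   term indexed by sw can produce it. *)
have imgw : imgM W S J sigma s (val w) u = 1.
  have := imgM_quadratic u sS; case: (ltngtP (htK u) (htK w)) ne => // lt _.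
    rewrite (@imgM_asc s u) -wE // evK_val opM_ev => ->.
    by rewrite !ffunE uw eqxx mulr0 addr0.
  have Iu : imgM W S J sigma s (val u) = ev w + sc (xL - xiL) (ev u).
    by rewrite imgM_des -wE // evK_val.
  have -> : opM W S J sigma s (imgM W S J sigma s (val u)) =
      imgM W S J sigma s (val w) + sc (xL - xiL) (imgM W S J sigma s (val u)).
    rewrite {1}Iu (semilinD lin); congr (_ + _); first exact: opM_ev.
    by rewrite (semilinZ lin); congr sc; exact: opM_ev.
  move=> /addIr ->.
  by rewrite ffunE eqxx.
move: imgw; have [lt|gt|eq] := ltngtP (ht S J (Defs.actK W S J s (val w))) (htK w).
- rewrite imgM_des // !ffunE uw mulr0 addr0; case: eqP => // _ /eqP.
  by rewrite eq_sym oner_eq0.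
- rewrite imgM_asc // !ffunE; case: eqP => // _ /eqP.
  by rewrite eq_sym oner_eq0.
- by rewrite imgM_eq // !ffunE uw mulr0 => /eqP; rewrite eq_sym oner_eq0.
Qed.

Section Step.
Variables (s : gT) (sS : s \in S).

Lemma val_stepK u : ht S J (Defs.actK W S J s (val u)) != htK u ->
  val (stepK s u) = Defs.actK W S J s (val u).
Proof.
by move=> ne; rewrite /stepK (negPf ne) val_insubd actK_closed.
Qed.

Lemma htK_stepK u : htK (stepK s u) = ht S J (Defs.actK W S J s (val u)).
Proof.
have [eq|ne] := eqVneq (ht S J (Defs.actK W S J s (val u))) (htK u).
  by rewrite /stepK eq eqxx.
by rewrite /htK val_stepK.
Qed.

Lemma stepK_fix u : htK (stepK s u) = htK u -> stepK s u = u.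
Proof. by rewrite htK_stepK /stepK => ->; rewrite eqxx. Qed.

Lemma evK_stepK u : htK (stepK s u) != htK u ->
  evK W S J (Defs.actK W S J s (val u)) = ev (stepK s u).
Proof. by rewrite htK_stepK => ne; rewrite -(val_stepK ne) evK_val. Qed.

Lemma stepKK : involutive (stepK s).
Proof.
move=> u; have [eq|ne] := eqVneq (htK (stepK s u)) (htK u).
  by rewrite !(stepK_fix eq).
have uE : val (stepK s u) = Defs.actK W S J s (val u).
  by apply: val_stepK; rewrite -htK_stepK.
have E := actK_invol sS uE ne.
by apply/val_inj; rewrite val_stepK E // -/(htK u) eq_sym.
Qed.

Definition diagK (u : KT W S J) : laurent :=
  if (htK u < htK (stepK s u))%N then 0
  else if (htK (stepK s u) < htK u)%N then xL - xiL
  else if sgnK sigma s (val u) == -1 then - xiL else xL.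

Lemma imgM_stepK u : imgM W S J sigma s (val u) =
  (if htK (stepK s u) == htK u then 0 else ev (stepK s u)) + sc (diagK u) (ev u).
Proof.
rewrite /diagK; have [lt|lt|eq] := ltngtP (htK (stepK s u)) (htK u).
- have ne : htK (stepK s u) != htK u by rewrite ltn_eqF.
  by rewrite htK_stepK in lt; rewrite (imgM_des lt) (evK_stepK ne).
- have ne : htK (stepK s u) != htK u by rewrite gtn_eqF.
  by rewrite htK_stepK in lt; rewrite (imgM_asc lt) (evK_stepK ne) sc0 addr0.
- by rewrite htK_stepK in eq; rewrite (imgM_eq eq) add0r.
Qed.

(** The off-diagonal part of H_s is the matrix of an involution, hence symmetric, so entries of H_s
    m are read off at [stepK s v]. *)
Lemma opM_stepK m v : opM W S J sigma s m v =
  (if htK (stepK s v) == htK v then 0 else m (stepK s v)) + diagK v * m v.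
Proof.
rewrite /opM sum_ffunE.
transitivity
  (\sum_u (if htK (stepK s u) == htK u then 0 else m u * (v == stepK s u)%:R) +
   \sum_u diagK u * m u * (v == u)%:R).
  rewrite -big_split; apply: eq_bigr => u _ /=.
  rewrite imgM_stepK vec_scE ffunE mulrDr; congr (_ + _).
    by case: ifP => _; rewrite ffunE ?mulr0.
  by rewrite !ffunE mulrCA mulrA.
congr (_ + _).
  rewrite (bigD1 (stepK s v)) //= stepKK eqxx mulr1 big1 => [|u uv].
    by rewrite addr0 eq_sym.
  have -> : (v == stepK s u) = false by rewrite -(inv_eq stepKK) eq_sym; apply/negbTE.
  by rewrite mulr0 if_same.
rewrite (bigD1 v) //= eqxx mulr1 big1 ?addr0 // => u /negPf uv.
by rewrite eq_sym uv mulr0.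
Qed.

Definition negK (u : KT W S J) : bool := sgnK sigma s (val u) == -1.

Lemma is_des_AscM u : is_des htK (stepK s) negK u = (s \notin AscM W S J sigma (val u)).
Proof.
rewrite inE sS /= -htK_stepK -/(htK u) -/(negK u) /is_des.
by case: ltngtP.
Qed.

Lemma rhoM_asc m v : (htK v < htK (stepK s v))%N -> rhoM s m v = m (stepK s v).
Proof.
by move=> lt; rewrite hrhoMs // opM_stepK /diagK lt gtn_eqF // mul0r addr0.
Qed.

Lemma rhoM_des m v : (htK (stepK s v) < htK v)%N ->
  rhoM s m v = m (stepK s v) + (xL - xiL) * m v.
Proof.
move=> lt; rewrite hrhoMs // opM_stepK /diagK lt ltn_eqF //.
by rewrite ltnNge ltnW.
Qed.

Lemma rhoM_eq m v : htK (stepK s v) = htK v ->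
  rhoM s m v = (if negK v then - xiL else xL) * m v.
Proof.
by move=> eq; rewrite hrhoMs // opM_stepK /diagK eq ltnn eqxx add0r.
Qed.

(** The index u makes the module nonzero, as [len_mul_neq] requires. *)
Lemma htK_step_le u : (htK (stepK s u) <= (htK u).+1)%N.
Proof.
rewrite htK_stepK; apply: (ht_step hcox JS) => // [s' w s'S wW|]; last exact: valP u.
exact: (len_mul_neq WS S2 hrhoM u).
Qed.

Lemma rhoM_linear : semilin idL (rhoM s).
Proof. by apply: (hecke_linear hrhoM); rewrite WS mem_gen. Qed.

Lemma rhoM_quadratic m : rhoM s (rhoM s m) = m + sc (xL - xiL) (rhoM s m).
Proof. exact: (hecke_quadratic WS S2 hrhoM). Qed.

End Step.

(** * The canonical basis and its W-graph *)

Variables (barL : {rmorphism laurent -> laurent}) (hbarx : barL xL = xiL).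
Variable barM : vec (KT W S J) -> vec (KT W S J).
Hypothesis hbar_anti : semilin barL barM.
Hypothesis hbar_H :
  forall w, w \in W -> forall m, rhoM w^-1%g (barM (rhoM w m)) = barM m.
Hypothesis hbar_fix :
  forall tau : KT W S J, DesLtEmpty W S J (val tau) -> barM (ev tau) = ev tau.
Variable C : KT W S J -> vec (KT W S J).
Hypothesis hCbar : forall tau, barM (C tau) = C tau.
Hypothesis hCdiag : forall tau, C tau tau = 1.
Hypothesis hCoff : forall tau u, u != tau ->
  (precK W S J (val u) (val tau) -> in_xiZxi (C tau u)) /\
  (~~ precK W S J (val u) (val tau) -> C tau u = 0).

Lemma can_low t u : u != t -> C t u != 0 -> (htK u < htK t)%N.
Proof.
move=> ut; have [_ H] := hCoff ut; apply: contraNT => lt; apply/eqP/H.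
by apply: contra lt => /and3P[].
Qed.

Lemma can_neg t u : u != t -> negL (C t u).
Proof.
move=> /hCoff[H1 H0]; case: (boolP (precK W S J (val u) (val t))) => [/H1|/H0 ->].
  exact: in_xiZxi_neg.
by move=> k _; rewrite coefL0.
Qed.

Lemma rhoM_bar s m : s \in S -> rhoM s (barM (rhoM s m)) = barM m.
Proof.
by move=> sS; rewrite -{1}(genS_inv S2 sS) hbar_H // WS mem_gen.
Qed.

Lemma rhoM_can_des s v : s \in S -> s \notin IC W S J sigma v ->
  rhoM s (C v) = sc xL (C v).
Proof.
move=> sS; rewrite /IC -(is_des_AscM sS).
apply: (T_can_des hbarx hbar_anti hCbar hCdiag can_low can_neg (stepKK sS)
  (stepK_fix sS) (rhoM_linear sS) (rhoM_asc sS) (rhoM_des sS) (rhoM_eq sS)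
  (rhoM_quadratic sS)).
by move=> m; apply: rhoM_bar.
Qed.

Lemma rhoM_can_asc s u : s \in S -> s \in IC W S J sigma u ->
  rhoM s (C u) = sc (- xiL) (C u) +
    \sum_(v | s \notin IC W S J sigma v) sc (omegaC W S J sigma C u v) (C v).
Proof.
move=> sS su.
have du : is_des htK (stepK s) (negK s) u = false by rewrite is_des_AscM // [_ \in _]su.
rewrite (T_can_asc hbarx hbar_anti hCbar hCdiag can_low can_neg (stepKK sS)
  (stepK_fix sS) (rhoM_linear sS) (rhoM_asc sS) (rhoM_des sS) (rhoM_eq sS)
  (rhoM_quadratic sS) (fun m => rhoM_bar m sS) du); congr (_ + _).
apply: eq_big => [v|v]; rewrite is_des_AscM // => sv.
(* Here s lies in the label of u but not in that of v, so the weight is the sum of the two mu. *)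
rewrite /omegaC; case: (boolP (_ \subset _)) => // /subsetP/(_ s su).
by rewrite (negPf sv).
Qed.

Lemma phiC_bij : bijective (phiC W S J C).
Proof. exact: (cphi_bij hCdiag can_low). Qed.

Lemma phiC_linear : semilin idL (phiC W S J C).
Proof. exact: cphi_linear. Qed.

Lemma phiC_opY s y : s \in S ->
  phiC W S J C (opY (omegaC W S J sigma C) (IC W S J sigma) s y) =
  rhoM s (phiC W S J C y).
Proof.
move=> sS; rewrite /opY (semilin_lincomb phiC_linear) {2}/phiC.
rewrite (semilin_lincomb (rhoM_linear sS)); apply: eq_bigr => u _; congr (sc _ _).
rewrite /imgY; case: (boolP (s \in _)) => su /=.
  rewrite phiC_linear (semilin_lincomb phiC_linear) rhoM_can_asc //.
  by congr (sc _ _ + _); [exact: cphi_ev | apply: eq_bigr => v _; congr sc; exact: cphi_ev].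
rewrite (semilinZ phiC_linear) rhoM_can_des //; congr sc; exact: cphi_ev.
Qed.

(** Both vectors are bar invariant and their difference has all entries in x^-1 Z[x^-1]. *)
Lemma can_DesLtEmpty v : DesLtEmpty W S J (val v) -> C v = ev v.
Proof.
move=> /hbar_fix vb; apply/eqP; rewrite -subr_eq0; apply/eqP.
apply: (bar_neg_eq0 hbarx hbar_anti hCbar hCdiag can_low).
  by rewrite (semilinD hbar_anti) (semilinN hbar_anti) hCbar vb.
move=> u; rewrite !ffunE; have [->|uv] := eqVneq u v.
  by rewrite hCdiag subrr => k _; rewrite coefL0.
by rewrite subr0; apply: can_neg.
Qed.

(** Induction on the height: a strict descent s writes v as s applied to a lower index, to which
    [parity_step] applies; otherwise C_v = M_v. *)
Lemma can_parity v u : parL (C v u) (htK v + htK u).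
Proof.
have [n] := ubnP (htK v); elim: n v u => // n IH v u hv.
case: (boolP (DesLtEmpty W S J (val v))) => [/can_DesLtEmpty ->|].
  rewrite ffunE; have [->|_] := eqVneq u v; last exact: parL0.
  by apply: parL1; rewrite addnn odd_double.
rewrite negb_forall_in => /exists_inP[s sS]; rewrite negbK -htK_stepK // -/(htK v) => lt.
have hs := htK_step_le sS; have := hs (stepK s v); rewrite stepKK // => le.
have e : htK (stepK s (stepK s v)) = (htK (stepK s v)).+1 by rewrite stepKK //; lia.
rewrite -[v](stepKK sS).
apply: (parity_step hbarx hbar_anti hCbar hCdiag can_low can_neg (stepKK sS)
  (stepK_fix sS) (rhoM_asc sS) (rhoM_des sS) (rhoM_eq sS) (rhoM_quadratic sS)
  (fun m => rhoM_bar m sS) e hs) => [w|w hw w']; apply: IH; lia.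
Qed.

Lemma omegaC_quasi_admissible :
  quasi_admissible (omegaC W S J sigma C) (IC W S J sigma).
Proof.
split.
(* The two classes are the parities of the height: a nonzero mu sits at the odd exponent -1, so the
   two heights have different parity. *)
- exists (fun u => odd (htK u)) => u v; rewrite /omegaC; case: ifP => [_|]; last by rewrite eqxx.
  have [E|/can_parity] := eqVneq (muC W S J C v u) 0; last first.
    by rewrite oddD; case: (odd (htK u)); case: (odd (htK v)).
  have [E'|/can_parity] := eqVneq (muC W S J C u v) 0; last first.
    by rewrite oddD; case: (odd (htK u)); case: (odd (htK v)).
  by rewrite E E' addr0 eqxx.
- by move=> u v; rewrite /omegaC; case: ifP => _; [eexists | exists 0].
- by move=> u v; rewrite /omegaC /IC => ->.
- by move=> u v; rewrite /omegaC /IC => -> ->; rewrite addrC.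
Qed.

Lemma omegaC_is_Wgraph : is_Wgraph W S (omegaC W S J sigma C) (IC W S J sigma).
Proof.
split=> [u|]; first by apply/subsetP => s; rewrite inE => /andP[].
have [g phiK gK] := phiC_bij; have phi_inj := can_inj phiK.
(* The Hecke action on M^sigma is pulled back along the bijection [phiC]. *)
exists (fun w y => g (rhoM w (phiC W S J C y))); split; last first.
  by move=> s sS y; apply: phi_inj; rewrite gK phiC_opY.
have [Hlin H1 HS] := hrhoM; split.
- by move=> w wW a m m'; apply: phi_inj; rewrite !phiC_linear !gK Hlin.
- by move=> m; rewrite H1.
- move=> s w sS wW m; apply: phi_inj; rewrite !gK HS //; case: ifP => _; rewrite ?gK //.
  by rewrite (semilinD phiC_linear) (semilinZ phiC_linear) !gK.
Qed.

Lemma phiC_equivariant rhoY : hecke_rep W S rhoY ->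
  (forall s, s \in S -> forall y,
     rhoY s y = opY (omegaC W S J sigma C) (IC W S J sigma) s y) ->
  forall w, w \in W -> forall y, phiC W S J C (rhoY w y) = rhoM w (phiC W S J C y).
Proof.
move=> hY hYs w wW; have {}wW : w \in <<S>>%g by rewrite -WS.
elim/length_ind: w / wW => [y|s w sS wW lt IH y].
  by have [_ -> _] := hY; have [_ -> _] := hrhoM.
have wW' : w \in W by rewrite WS.
by rewrite (hecke_mul hY) // (hecke_mul hrhoM) // hYs // phiC_opY // IH.
Qed.

End PerfectModel.

Theorem mainTheorem15
  (gT : finGroupType) (W : {group gT}) (S J : {set gT})
  (hcox : coxeter_system W S) (hJ : J \subset S)
  (sigma : gT -> int)
  (hsig1 : forall y, y \in <<J>>%g -> sigma y = 1 \/ sigma y = -1)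
  (hsigM : forall y y', y \in <<J>>%g -> y' \in <<J>>%g ->
             sigma (y * y')%g = sigma y * sigma y')
  (* the H-module structure of M^sigma *)
  (rhoM : gT -> vec (KT W S J) -> vec (KT W S J))
  (hrhoM : hecke_rep W S rhoM)
  (hrhoMs : forall s, s \in S -> forall m, rhoM s m = opM W S J sigma s m)
  (* the bar involution of Z[x,x^-1] *)
  (barL : {rmorphism laurent -> laurent}) (hbarx : barL xL = xiL)
  (* the bar operator of M^sigma *)
  (barM : vec (KT W S J) -> vec (KT W S J))
  (hbar_anti : forall a m m', barM (sc a m + m') = sc (barL a) (barM m) + barM m')
  (hbar_H : forall w, w \in W -> forall m, rhoM w^-1%g (barM (rhoM w m)) = barM m)
  (hbar_fix : forall tau : KT W S J, DesLtEmpty W S J (val tau) -> barM (ev tau) = ev tau)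
  (* the canonical basis: C tau = underline M^sigma_tau *)
  (C : KT W S J -> vec (KT W S J))
  (hCbar : forall tau, barM (C tau) = C tau)
  (hCdiag : forall tau, C tau tau = 1)
  (hCoff : forall tau u, u != tau ->
     (precK W S J (val u) (val tau) -> in_xiZxi (C tau u)) /\
     (~~ precK W S J (val u) (val tau) -> C tau u = 0)) :
  is_Wgraph W S (omegaC W S J sigma C) (IC W S J sigma) /\
  quasi_admissible (omegaC W S J sigma C) (IC W S J sigma) /\
  bijective (phiC W S J C) /\
  (forall rhoY : gT -> vec (KT W S J) -> vec (KT W S J),
     hecke_rep W S rhoY ->
     (forall s, s \in S -> forall y,
        rhoY s y = opY (omegaC W S J sigma C) (IC W S J sigma) s y) ->
     forall w, w \in W -> forall y, phiC W S J C (rhoY w y) = rhoM w (phiC W S J C y)).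
Proof.
have anti : semilin barL barM := hbar_anti.
have wg := omegaC_is_Wgraph hcox hrhoM hrhoMs hbarx anti hbar_H hCbar hCdiag hCoff.
have qa := omegaC_quasi_admissible hcox hJ hrhoM hrhoMs hbarx anti hbar_H hbar_fix
  hCbar hCdiag hCoff.
have bij := phiC_bij hCdiag hCoff.
have equi := phiC_equivariant hcox hrhoM hrhoMs hbarx anti hbar_H hCbar hCdiag hCoff.
by do 3 (split => //).
Qed.
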